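(* Let $M_c$, $c\in(0,\infty)$, be the non-totally geodesic rotational minimal surface (catenoid) in $\mathbb{H}^3$ with parameter $c$. The renormalized area of $M_c$ can be expressed in terms of standard complete elliptic integrals as $$\mathcal{A}_R(M_c)=\frac{4\pi}{\sqrt{2\zeta^2-1}}\left((1-\zeta^2)K(\zeta)-E(\zeta)\right),$$ where $\zeta\in(\sqrt{2}/2,1)$ is given in terms of $c>0$ by $$\zeta=\sqrt{\frac{c^2+\sqrt{c^4+4}}{2\sqrt{c^4+4}}}.$$ Moreover, the renormalized area $\mathcal{A}_R(M_c)$ has a unique critical point (a maximum), at the value $\zeta_+\in(\sqrt{2}/2,1)$ such that $K(\zeta_+)=2E(\zeta_+)$. Hence, $\mathcal{A}_R(M_c)$ increases from $-\infty$, when $c\to0^+$, to its maximum $$\mathcal{A}_R^+=-4\pi\sqrt{2\zeta_+^2-1}\,E(\zeta_+)\in(-4\pi,-\pi^2),$$ and then decreases approaching $-4\pi$, as $c\to\infty$.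
   Context: The complete elliptic integrals of the first and second kind are $K(\zeta)=\int_0^1\frac{dx}{\sqrt{(1-x^2)(1-\zeta^2x^2)}}$ and $E(\zeta)=\int_0^1\frac{\sqrt{1-\zeta^2x^2}}{\sqrt{1-x^2}}\,dx$. Hyperbolic space is the hyperboloid $\mathbb{H}^{3}=\{(x_1,x_2,x_3,z)\in\mathbb{R}^{4}: x_1^2+x_2^2+x_3^2-z^2=-1,\ z>0\}$ with the metric induced by $dx_1^2+dx_2^2+dx_3^2-dz^2$. Catenoids. Rotational surfaces are those invariant under $O(2)$ acting on $(x_1,x_2)$; non-totally geodesic rotational minimal surfaces are called catenoids and form a one-parameter family $\{M_c\}_{c>0}$ described as follows. Let $\alpha=(c^2+\sqrt{c^4+4})/2$ be the positive root of $-u^2+c^2u+1$, let $u(s)=\frac{2}{\sqrt{c^4+4}\cosh(2s)-c^2}$, which is the non-constant smooth solution of $(u')^2=4u^2(-u^2+c^2u+1)$ with $u(0)=\alpha$, and let $v(s)=-c\int_0^s\frac{u^{3/2}}{1+c^2u}\,d\sigma$. Then $M_c$ is the surface parameterized by $$X_c(s,\theta)=\frac{1}{c\sqrt{u}}\left(\cos\theta,\sin\theta,\sqrt{1+c^2u}\,\sinh v(s),\sqrt{1+c^2u}\,\cosh v(s)\right),\quad s\in\mathbb{R},\ \theta\in\mathbb{R}/2\pi\mathbb{Z}.$$ Renormalized area. For a surface $M\subset\mathbb{H}^{3}$ the renormalized area $\mathcal{A}_R(M)$ is the constant term in the expansion, in powers of $\epsilon>0$ as $\epsilon\to0^+$,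 of the area of the truncated surface $M_\epsilon=M\cap\{z\le 1/\epsilon\}$. *)

(* Defs.v *)
From HB Require Import structures.
From mathcomp Require Import all_boot all_order all_algebra.
From mathcomp Require Import all_classical all_reals all_analysis.
Set Implicit Arguments.
Unset Strict Implicit.
Unset Printing Implicit Defensive.
Import Order.TTheory GRing.Theory Num.Theory.
Import numFieldNormedType.Exports.
Local Open Scope classical_set_scope.
Local Open Scope ring_scope.

Section elliptic_integrals.
Context {R : realType}.
Notation mu := (@lebesgue_measure R).

(* The integrands are nonnegative and singular at most at the endpoint x = 1
   (for 0 <= z < 1), so the Lebesgue integrals over [0, 1] are the usual
   improper integrals. *)
Definition ellipticK (z : R) : R :=
  \int[mu]_(x in `[0, 1]) (Num.sqrt ((1 - x ^+ 2) * (1 - z ^+ 2 * x ^+ 2)))^-1.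

Definition ellipticE (z : R) : R :=
  \int[mu]_(x in `[0, 1])
    (Num.sqrt (1 - z ^+ 2 * x ^+ 2) / Num.sqrt (1 - x ^+ 2)).

End elliptic_integrals.

Section surfaces.
Context {R : realType}.
Notation mu := (@lebesgue_measure R).

Definition x1 : 'I_4 := inord 0.
Definition x2 : 'I_4 := inord 1.
Definition x3 : 'I_4 := inord 2.
Definition xz : 'I_4 := inord 3.

(* dx1^2 + dx2^2 + dx3^2 - dz^2, whose restriction is the metric of the
   hyperboloid model of H^3 *)
Definition lorentz (p q : 'rV[R]_4) : R :=
  p ord0 x1 * q ord0 x1 + p ord0 x2 * q ord0 x2 + p ord0 x3 * q ord0 x3
  - p ord0 xz * q ord0 xz.

Definition partial1 (X : R * R -> 'rV[R]_4) (p : R * R) : 'rV[R]_4 :=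
  \row_i derive1 (fun s : R => X (s, p.2) ord0 i) p.1.

Definition partial2 (X : R * R -> 'rV[R]_4) (p : R * R) : 'rV[R]_4 :=
  \row_i derive1 (fun t : R => X (p.1, t) ord0 i) p.2.

(* sqrt (EG - F^2) for the first fundamental form of X *)
Definition area_density (X : R * R -> 'rV[R]_4) (p : R * R) : R :=
  Num.sqrt (lorentz (partial1 X p) (partial1 X p)
            * lorentz (partial2 X p) (partial2 X p)
            - lorentz (partial1 X p) (partial2 X p) ^+ 2).

(* Area of M `&` B, where M is the surface parameterized (bijectively) by X
   on the parameter domain D. *)
Definition area (D : set (R * R)) (X : R * R -> 'rV[R]_4) (B : set 'rV[R]_4)
    : \bar R :=
  (\int[mu \x mu]_(p in D `&` X @^-1` B) (area_density X p)%:E)%E.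

Definition truncated_area (D : set (R * R)) (X : R * R -> 'rV[R]_4) (e : R)
    : \bar R :=
  area D X [set q | q ord0 xz <= e^-1].

(* A is the constant term of an expansion
   a_(n-1) e^(-n) + ... + a_0 e^(-1) + A + O(e)  as e -> 0+;
   such an A is unique. In particular the truncated areas are finite. *)
Definition is_renormalized_area (D : set (R * R)) (X : R * R -> 'rV[R]_4)
    (A : R) : Prop :=
  exists (n : nat) (a : nat -> R) (C : R),
    \forall e \near (0 : R)^'+,
      (`| truncated_area D X e - (\sum_(k < n) a k * e ^- k.+1 + A)%:E |
        <= (C * e)%:E)%E.

(* 0 is a junk value for surfaces having no such expansion *)
Definition renormalized_area (D : set (R * R)) (X : R * R -> 'rV[R]_4) : R :=
  xget 0 [set A | is_renormalized_area D X A].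

End surfaces.

Section catenoids.
Context {R : realType}.
Notation mu := (@lebesgue_measure R).

Definition cosh (x : R) : R := (expR x + expR (- x)) / 2.
Definition sinh (x : R) : R := (expR x - expR (- x)) / 2.

(* Integral from a to b with the usual sign convention when b < a; one of the
   two intervals is always negligible. *)
Definition oriented_integral (a b : R) (f : R -> R) : R :=
  \int[mu]_(x in `[a, b]) f x - \int[mu]_(x in `[b, a]) f x.

Definition catenoid_u (c s : R) : R :=
  2 / (Num.sqrt (c ^+ 4 + 4) * cosh (2 * s) - c ^+ 2).

Definition catenoid_v (c s : R) : R :=
  - c * oriented_integral 0 s
    (fun t => catenoid_u c t `^ (3 / 2) / (1 + c ^+ 2 * catenoid_u c t)).

Definition catenoid_X (c : R) (p : R * R) : 'rV[R]_4 :=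
  let: (s, t) := p in
  let u := catenoid_u c s in
  let v := catenoid_v c s in
  (c * Num.sqrt u)^-1 *:
    \row_i [:: cos t; sin t; Num.sqrt (1 + c ^+ 2 * u) * sinh v;
               Num.sqrt (1 + c ^+ 2 * u) * cosh v]`_i.

(* R x [0, 2 pi[, a fundamental domain for R x (R / 2 pi Z) *)
Definition catenoid_domain : set (R * R) := setT `*` `[0, 2 * pi[.

Definition is_catenoid_AR (c A : R) : Prop :=
  is_renormalized_area catenoid_domain (catenoid_X c) A.

Definition catenoid_AR (c : R) : R :=
  renormalized_area catenoid_domain (catenoid_X c).

Definition zeta (c : R) : R :=
  Num.sqrt ((c ^+ 2 + Num.sqrt (c ^+ 4 + 4)) / (2 * Num.sqrt (c ^+ 4 + 4))).

End catenoids.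

(* Main.v *)
Require Import Defs.
From HB Require Import structures.
From mathcomp Require Import all_boot all_order all_algebra.
From mathcomp Require Import all_classical all_reals all_analysis.
From mathcomp Require Import measurable_realfun ring lra.
Set Implicit Arguments.
Unset Strict Implicit.
Unset Printing Implicit Defensive.
Import Order.TTheory GRing.Theory Num.Theory.
Import numFieldNormedType.Exports.
Local Open Scope classical_set_scope.
Local Open Scope ring_scope.

(** The first fundamental form of [catenoid_X c] is [ds^2 + r(s)^2 dt^2], where
    [r] is the radius [cat_r] of the rotation circle ([catenoid_unit_speed],
    [catenoid_area_density]). The coordinate bounded by the truncation is even
    in [s] and increasing for [s >= 0], so the truncated area is
    [4 * pi] times the integral of [r] from [0] to [S], where [S] is determined
    by the truncation level ([truncated_area_catenoid]).

    In terms of the modulus [z = zeta c], [r(s)] is a constant times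
    [sqrt (cosh s ^ 2 - z ^ 2)]. Subtracting the derivative of
    [sinh s / cosh s * sqrt (cosh s ^ 2 - z ^ 2)] and substituting
    [sin t = 1 / cosh s], with [t] the angle of parallelism, leaves the integral
    of [z ^ 2 * cos t ^ 2 / sqrt (1 - z ^ 2 * sin t ^ 2)], whose value over the
    quarter period is [ellipticG z = E(z) - (1 - z ^ 2) * K(z)]
    ([profile_integral]). The translation along the axis converges
    exponentially fast ([catenoid_v_limit]), so the level [1 / e] equals a
    constant times [exp S] up to [O(e)], and so does the boundary term. Hence
    the truncated area has one polar term, and its constant term is
    [- 4 * pi * ellipticG z / sqrt (2 * z ^ 2 - 1)] ([area_expansion],
    [catenoid_renormalized]); a constant term is unique
    ([is_renormalized_area_unique]).

    The rest is the study of this function. Differentiation under the integral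
    sign and one integration by parts give [ellipticG' = z * K]
    ([has_deriv_ellipticG]), so that the derivative of the renormalized area
    has the sign of [2 * E - K] ([has_deriv_AR_modulus]). The difference
    [K - 2 * E] increases strictly with the modulus ([K2E_lt]), is negative at
    [sqrt 2 / 2] and positive close to [1], where [K] diverges logarithmically
    ([K2E_low], [K2E_high]). It therefore vanishes exactly once, and since
    [zeta] increases from [sqrt 2 / 2] to [1], this proves the monotonicity and
    the uniqueness of the critical point. The limits and the bounds on the
    maximum come from the estimates [z ^ 2 * pi / 4 <= ellipticG z <= 1] and
    [1 - sqrt (1 - z ^ 2) * pi / 2 <= ellipticG z]. *)

(** * Calculus for explicit real functions *)

Section calculus.
Context {R : realType}.
Notation mu := (@lebesgue_measure R).
Implicit Types (f g F : R -> R) (a b x s d : R).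

(** [is_derive] is a type class whose instances speak of point-free sums and
    products; a plain proposition lets the rules below be applied to pointwise
    expressions by syntactic matching, without instance search. *)
Definition has_deriv f x d : Prop := is_derive x 1 f d.

Lemma has_deriv_eq f x d d' : has_deriv f x d -> d = d' -> has_deriv f x d'.
Proof. by move=> ? <-. Qed.

Lemma has_deriv_cst a x : has_deriv (fun=> a) x 0.
Proof. exact: is_derive_cst. Qed.

Lemma has_deriv_id x : has_deriv (fun y => y) x 1.
Proof. exact: is_derive_id. Qed.

Lemma has_derivD f g x a b : has_deriv f x a -> has_deriv g x b ->
  has_deriv (fun y => f y + g y) x (a + b).
Proof. by move=> ? ?; apply: is_deriveD. Qed.

Lemma has_derivN f x a : has_deriv f x a -> has_deriv (fun y => - f y) x (- a).
Proof. by move=> ?; apply: is_deriveN. Qed.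

Lemma has_derivM f g x a b : has_deriv f x a -> has_deriv g x b ->
  has_deriv (fun y => f y * g y) x (f x * b + g x * a).
Proof. by move=> ? ?; apply: is_deriveM. Qed.

Lemma has_derivX f n x a : has_deriv f x a ->
  has_deriv (fun y => f y ^+ n.+1) x (n.+1%:R * f x ^+ n * a).
Proof.
by move=> fa; have := @is_deriveX _ _ f n.+1 x 1 a fa; rewrite exprfctE.
Qed.

Lemma has_derivV f x a : f x != 0 -> has_deriv f x a ->
  has_deriv (fun y => (f y)^-1) x (- (f x) ^- 2 * a).
Proof. by move=> ? ?; apply: is_deriveV. Qed.

Lemma has_deriv_comp f g x a b : has_deriv f (g x) a -> has_deriv g x b ->
  has_deriv (fun y => f (g y)) x (a * b).
Proof. by move=> ? ?; apply: (@is_derive1_comp _ f g). Qed.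

Lemma has_deriv_sqrt f x a : 0 < f x -> has_deriv f x a ->
  has_deriv (fun y => Num.sqrt (f y)) x ((2 * Num.sqrt (f x))^-1 * a).
Proof. by move=> f0; apply: has_deriv_comp; exact: is_derive1_sqrt. Qed.

Lemma has_deriv_expR f x a : has_deriv f x a ->
  has_deriv (fun y => expR (f y)) x (expR (f x) * a).
Proof. by apply: has_deriv_comp; exact: is_derive_expR. Qed.

Lemma has_deriv_sin f x a : has_deriv f x a ->
  has_deriv (fun y => sin (f y)) x (cos (f x) * a).
Proof. by apply: has_deriv_comp; exact: is_derive_sin. Qed.

Lemma has_deriv_cos f x a : has_deriv f x a ->
  has_deriv (fun y => cos (f y)) x (- sin (f x) * a).
Proof. by apply: has_deriv_comp; exact: is_derive_cos. Qed.

Lemma has_deriv_atan f x a : has_deriv f x a ->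
  has_deriv (fun y => atan (f y)) x ((1 + f x ^+ 2)^-1 * a).
Proof. by apply: has_deriv_comp; exact: is_derive1_atan. Qed.

Lemma has_deriv_ln f x a : 0 < f x -> has_deriv f x a ->
  has_deriv (fun y => ln (f y)) x ((f x)^-1 * a).
Proof. by move=> f0; apply: has_deriv_comp; exact: is_derive1_ln. Qed.

Lemma has_deriv_cosh f x a : has_deriv f x a ->
  has_deriv (fun y => cosh (f y)) x (sinh (f x) * a).
Proof.
move=> fa; rewrite /cosh; apply: has_deriv_eq.
  apply: has_derivM; last exact: has_deriv_cst.
  apply: has_derivD; apply: has_deriv_expR; first exact: fa.
  by apply: has_derivN; exact: fa.
by rewrite /sinh; field.
Qed.

Lemma has_deriv_sinh f x a : has_deriv f x a ->
  has_deriv (fun y => sinh (f y)) x (cosh (f x) * a).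
Proof.
move=> fa; rewrite /sinh; apply: has_deriv_eq.
  apply: has_derivM; last exact: has_deriv_cst.
  apply: has_derivD; last apply: has_derivN; apply: has_deriv_expR.
    exact: fa.
  by apply: has_derivN; exact: fa.
by rewrite /cosh; field.
Qed.

Lemma has_deriv_continuous f x d : has_deriv f x d -> {for x, continuous f}.
Proof.
by move=> /@ex_derive fx; apply/differentiable_continuous/derivable1_diffP.
Qed.

Lemma has_deriv_derive1 {f x d} : has_deriv f x d -> derive1 f x = d.
Proof. by move=> h; rewrite derive1E; exact: (@derive_val _ _ _ _ _ _ _ h). Qed.

Lemma continuous_integrable f a b : continuous f ->
  mu.-integrable `[a, b] (EFin \o f).
Proof.
move=> cf; apply: continuous_compact_integrable; first exact: segment_compact.
exact: continuous_subspaceT.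
Qed.

Lemma oriented_integral_ge0E f s : 0 <= s ->
  oriented_integral 0 s f = \int[mu]_(x in `[0, s]) f x.
Proof.
rewrite /oriented_integral le_eqVlt => /predU1P[<-|s0].
  by rewrite set_itv1 !Rintegral_set1 subr0.
rewrite [X in _ - X](_ : _ = 0) ?subr0// set_itv_ge ?bnd_simp -?ltNge//.
by rewrite Rintegral_set0.
Qed.

Lemma oriented_integralEl f a s : continuous f -> a <= 0 -> a <= s ->
  oriented_integral 0 s f =
  \int[mu]_(x in `[a, s]) f x - \int[mu]_(x in `[a, 0]) f x.
Proof.
move=> cf a0 as_.
have intf u v : mu.-integrable [set` Interval (BLeft u) (BRight v)] (EFin \o f).
  exact: continuous_integrable.
have split u v : a <= u -> u <= v ->
    \int[mu]_(x in `[a, v]) f x - \int[mu]_(x in `[a, u]) f x =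
    \int[mu]_(x in `[u, v]) f x.
  move=> au uv; rewrite Rintegral_itvB ?bnd_simp// Rintegral_itv_obnd_cbnd//.
  by apply: integrableS (intf u v) => //; exact: subset_itv_oc_cc.
have [s0|s0] := leP 0 s; first by rewrite oriented_integral_ge0E// split.
rewrite /oriented_integral -(split s 0 as_ (ltW s0)).
rewrite set_itv_ge ?bnd_simp -?ltNge// Rintegral_set0; ring.
Qed.

(** [continuous_FTC1_closed] applies strictly to the right of the base point;
    moving the base point to the left of both [0] and [s] reduces every [s] to
    that case. *)
Lemma has_deriv_oriented_integral f s : continuous f ->
  has_deriv (fun y => oriented_integral 0 y f) s (f s).
Proof.
move=> cf; pose a := Num.min 0 s - 1.
have a0 : a < 0 by rewrite /a ltrBlDr add0r gt_min ltr01.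
have as0 : a < s by rewrite /a ltrBlDr gt_min ltrDl ltr01 orbT.
have s1 : s < s + 1 by rewrite ltrDl.
have intf := continuous_integrable a (s + 1) cf.
have [dF F'] := continuous_FTC1_closed s1 intf as0 (cf s).
pose G y := \int[mu]_(x in `[a, y]) f x - \int[mu]_(x in `[a, 0]) f x.
have dG : has_deriv G s (f s).
  apply: has_deriv_eq; last exact: subr0.
  apply: has_derivD; last by apply: has_derivN; exact: has_deriv_cst.
  by apply: DeriveDef dF _; rewrite -derive1E.
apply: near_eq_is_derive dG; near=> y.
rewrite /G (@oriented_integralEl _ a)// ltW//.
by near: y; exact: lt_nbhsr.
Unshelve. all: by end_near. Qed.

Lemma oriented_integralFTC F f s : continuous f ->
  (forall y, has_deriv F y (f y)) -> oriented_integral 0 s f = F s - F 0.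
Proof.
move=> cf F'; pose G y := oriented_integral 0 y f - F y.
have : G s = G 0.
  apply: is_derive_0_is_cst => x; apply: has_deriv_eq.
    apply: has_derivD; first exact: has_deriv_oriented_integral.
    by apply: has_derivN; exact: F'.
  exact: subrr.
rewrite /G [oriented_integral 0 0 f]subrr sub0r => /eqP.
by rewrite subr_eq addrC => /eqP.
Qed.

Lemma has_deriv_gt0_lt f a b (d : R -> R) : a < b ->
  (forall x, a <= x <= b -> has_deriv f x (d x)) ->
  (forall x, a < x < b -> 0 < d x) -> f a < f b.
Proof.
move=> ab fd d0.
have cf : {within `[a, b], continuous f}.
  apply: derivable_within_continuous => x; rewrite in_itv/= => /fd h.
  exact: (@ex_derive _ _ _ _ _ _ _ h).
have [|x xab e] := @MVT R f d a b ab _ cf.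
  by move=> x; rewrite in_itv/= => /andP[/ltW ? /ltW ?]; apply: fd; apply/andP.
by rewrite -subr_gt0 e mulr_gt0 ?subr_gt0// d0// -in_itv.
Qed.

End calculus.

(** The positivity and nonvanishing side conditions are left as goals. The
    cases without a bound variable are eta-reduced forms that unification
    produces. *)
Ltac derive_rules :=
  lazymatch goal with
  | |- has_deriv (fun y => y) _ _ => exact: has_deriv_id
  | |- has_deriv (fun _ => ?a) _ _ => exact: has_deriv_cst
  | |- has_deriv (fun y => _ + _) _ _ => eapply has_derivD; derive_rules
  | |- has_deriv (fun y => - _) _ _ => eapply has_derivN; derive_rules
  | |- has_deriv (fun y => _ * _) _ _ => eapply has_derivM; derive_rules
  | |- has_deriv (fun y => _ ^+ _) _ _ => eapply has_derivX; derive_rules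
  | |- has_deriv (fun y => _^-1) _ _ => eapply has_derivV; [|derive_rules]
  | |- has_deriv (fun y => Num.sqrt _) _ _ =>
    eapply has_deriv_sqrt; [|derive_rules]
  | |- has_deriv (fun y => expR _) _ _ => eapply has_deriv_expR; derive_rules
  | |- has_deriv (fun y => sin _) _ _ => eapply has_deriv_sin; derive_rules
  | |- has_deriv (fun y => cos _) _ _ => eapply has_deriv_cos; derive_rules
  | |- has_deriv (fun y => atan _) _ _ => eapply has_deriv_atan; derive_rules
  | |- has_deriv (fun y => ln _) _ _ => eapply has_deriv_ln; [|derive_rules]
  | |- has_deriv (fun y => cosh _) _ _ => eapply has_deriv_cosh; derive_rules
  | |- has_deriv (fun y => sinh _) _ _ => eapply has_deriv_sinh; derive_rules
  | |- has_deriv (GRing.opp) _ _ =>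
    eapply (has_derivN (f := fun y => y)); exact: has_deriv_id
  | |- has_deriv (GRing.mul ?a) _ _ =>
    eapply (has_derivM (f := fun=> a) (g := fun y => y)); derive_rules
  | |- has_deriv (@sin _) _ _ => exact: is_derive_sin
  | |- has_deriv (@cos _) _ _ => exact: is_derive_cos
  | |- has_deriv (@cosh _) _ _ =>
    eapply (has_deriv_cosh (f := fun y => y)); exact: has_deriv_id
  | |- has_deriv (@sinh _) _ _ =>
    eapply (has_deriv_sinh (f := fun y => y)); exact: has_deriv_id
  | |- has_deriv (@atan _) _ _ => exact: is_derive1_atan
  | |- has_deriv (@expR _) _ _ => exact: is_derive_expR
  | |- _ => idtac
  end.

Ltac derive := eapply has_deriv_eq; [derive_rules|]; cbv beta.

(** * Complete elliptic integrals in trigonometric form *)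

Section substitution.
Context {R : realType}.
Notation mu := (@lebesgue_measure R).
Implicit Types (phi : R -> R) (x y t : R).

Let asinK_itv x : -1 <= x <= 1 -> sin (asin x) = x.
Proof. by move=> x1; rewrite asinK// in_itv. Qed.

Let sinK_itv t : - (pi / 2) <= t <= pi / 2 -> asin (sin t) = t :> R.
Proof. by move=> t1; rewrite sinK// in_itv. Qed.

Let sin_lt1 y : 0 <= y < pi / 2 -> 0 <= sin y < 1.
Proof.
move=> /andP[y0 y1]; have p0 := @pi_gt0 R.
rewrite sin_ge0_pi/=; last by rewrite y0/=; lra.
rewrite -sin_pihalf ltr_sin// in_itv/=; lra.
Qed.

Let has_deriv_asin x : -1 < x < 1 ->
  has_deriv (@asin R) x (Num.sqrt (1 - x ^+ 2))^-1.
Proof. by move=> x1; exact: is_derive1_asin. Qed.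

Let cphi_div phi x : (forall x, -1 < x < 1 -> {for x, continuous phi}) ->
  -1 < x < 1 -> {for x, continuous (fun x => phi x / Num.sqrt (1 - x ^+ 2))}.
Proof.
move=> cphi x1; apply: cvgM; first exact: cphi.
apply: cvgV; first by rewrite gt_eqF// sqrtr_gt0; nra.
apply: (has_deriv_continuous (f := fun x => Num.sqrt (1 - x ^+ 2))).
by derive; [nra|reflexivity].
Qed.

(** Stops short of the singularity at [1]. With the bound written [sin y], the
    passage to the limit below happens in [y] and does not involve the
    behavior of [asin] at [1]. *)
Lemma integral_sin_substitution_lt1 phi y : (forall x, 0 <= phi x) ->
  (forall x, -1 < x < 1 -> {for x, continuous phi}) ->
  continuous (phi \o sin) -> 0 < y < pi / 2 ->
  (\int[mu]_(x in `[0%R, sin y]) (phi x / Num.sqrt (1 - x ^+ 2))%:E)%E =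
  (oriented_integral 0 y (phi \o sin))%:E.
Proof.
move=> phi0 cphi cphis /andP[y0 y1].
have /andP[s0 s1] : 0 <= sin y < 1 by rewrite sin_lt1// y1 ltW.
have sy0 : 0 < sin y by apply: sin_gt0_pihalf; rewrite y0.
pose F x := oriented_integral 0 (asin x) (phi \o sin).
have FD x : -1 < x < 1 -> has_deriv F x (phi x / Num.sqrt (1 - x ^+ 2)).
  move=> x1; rewrite /F -{2}(@asinK_itv x); last lra.
  apply: (has_deriv_comp (f := fun u => oriented_integral 0 u (phi \o sin))).
    exact: (has_deriv_oriented_integral _ cphis).
  exact: has_deriv_asin.
have cF x : -1 < x < 1 -> {for x, continuous F}.
  by move=> /FD/has_deriv_continuous.
rewrite (@continuous_FTC2 _ _ F)//.
- rewrite [F (sin y)]/F sinK_itv; last lra.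
  have -> : F 0 = 0 by rewrite /F -[X in asin X]sin0 sinK_itv ?[LHS]subrr//; lra.
  by rewrite sube0.
- apply: continuous_in_subspaceT => x /set_mem.
  rewrite /= in_itv/= => /andP[x0 xs].
  by apply: cphi_div => //; lra.
- split.
  + move=> x; rewrite in_itv/= => /andP[x0 xs].
    apply: (@ex_derive _ _ _ _ _ _ _ (FD x _)); lra.
  + by apply: cvg_at_right_filter; apply: cF; lra.
  + by apply: cvg_at_left_filter; apply: cF; lra.
- move=> x; rewrite in_itv/= => /andP[x0 xs].
  apply: has_deriv_derive1; apply: FD; lra.
Qed.

(** The integrand is nonnegative, so exhausting the half-open interval by
    closed ones reduces the singular case to [integral_sin_substitution_lt1]
    by monotone convergence. *)
Lemma integral_sin_substitution phi : (forall x, 0 <= phi x) ->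
  (forall x, -1 < x < 1 -> {for x, continuous phi}) ->
  continuous (phi \o sin) ->
  \int[mu]_(x in `[0, 1]) (phi x / Num.sqrt (1 - x ^+ 2)) =
  \int[mu]_(t in `[0, pi / 2]) phi (sin t).
Proof.
move=> phi0 cphi cphis; have p1 := @pihalf_ge1 R; have p0 := @pi_gt0 R.
pose y n : R := pi / 2 - (n.+2%:R)^-1.
have yb n : 0 < y n < pi / 2.
  have n0 : 0 < (n.+2%:R : R)^-1 by rewrite invr_gt0.
  have n1 : (n.+2%:R : R)^-1 < 1 by rewrite invf_lt1 ?ltr1n.
  rewrite /y; move: n0 n1; set e := _^-1 => n0 n1; clearbody e.
  by apply/andP; split; lra.
pose f x := (phi x / Num.sqrt (1 - x ^+ 2))%:E.
pose g x := phi x / Num.sqrt (1 - x ^+ 2).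
have mf : measurable_fun (`[0, 1[%classic : set R) g.
  apply: (@measurable_funS _ _ _ _ (`]-1, 1[%classic : set R)) => //.
    by apply: subset_itvr; rewrite bnd_simp; lra.
  apply: open_continuous_measurable_fun => [|x]; first exact: interval_open.
  by rewrite inE/= in_itv/=; by move=> ?; exact: cphi_div.
have ycvg : y n @[n --> \oo] --> (pi / 2 : R).
  rewrite -[X in _ --> X]subr0; apply: cvgB; first exact: cvg_cst.
  by have := @cvg_harmonic R; rewrite -cvg_shiftS.
have bigcupE : \bigcup_n (`[0, sin (y n)]%classic : set R) = `[0, 1[%classic.
  apply/seteqP; split => x /=.
    move=> [n _] /=; rewrite !in_itv/= => /andP[-> /le_lt_trans]; apply.
    have /andP[yn0 yn1] := yb n.
    by have /andP[] : 0 <= sin (y n) < 1 by apply: sin_lt1; rewrite (ltW yn0).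
  rewrite in_itv/= => /andP[x0 x1].
  have ax : asin x < pi / 2 by apply: asin_ltpi2; lra.
  have /cvgrPdist_lt/(_ (pi / 2 - asin x)) := ycvg.
  rewrite subr_gt0 => /(_ ax)[N _ /(_ N (leqnn _))] /=.
  rewrite ltr_norml => /andP[_ yN]; exists N => //=.
  rewrite in_itv/= x0/= -[leLHS]asinK_itv; last lra.
  have /andP[yn0 yn1] := yb N.
  rewrite ltW// ltr_sin ?in_itv/=; first lra.
    by rewrite asin_geNpi2 ?ltW//; lra.
  lra.
have cv : (\int[mu]_(x in `[0%R, sin (y n)]) f x)%E @[n --> \oo] -->
          (\int[mu]_(x in `[0%R, 1%R[) f x)%E.
  rewrite -bigcupE; apply: ge0_nondecreasing_set_cvg_integral => //.
  - move=> m n mn; rewrite subsetEset; apply: subset_itvl; rewrite bnd_simp.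
    have /andP[? ?] := yb n; have /andP[? ?] := yb m.
    have ymn : y m <= y n by rewrite lerD2l lerN2 lef_pV2 ?posrE// ler_nat.
    by move: ymn; rewrite !le_eqVlt => /predU1P[->|]; rewrite ?eqxx// -ltr_sin
      ?in_itv/= => [->||]; rewrite ?orbT//; lra.
  - move=> n; apply/measurable_EFinP; apply: measurable_funS mf => //.
    by move=> x xn; rewrite -bigcupE; exists n.
  - by move=> n x _; rewrite lee_fin divr_ge0// sqrtr_ge0.
have cv' : (\int[mu]_(x in `[0%R, sin (y n)]) f x)%E @[n --> \oo] -->
          (oriented_integral 0 (pi / 2) (phi \o sin))%:E.
  under eq_fun do rewrite integral_sin_substitution_lt1//.
  apply: cvg_EFin; first exact: nearW.
  have := has_deriv_continuous (has_deriv_oriented_integral (pi / 2) cphis).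
  by apply: cvg_comp.
rewrite -[RHS]oriented_integral_ge0E; last lra.
transitivity (fine (\int[mu]_(x in `[0%R, 1%R[) f x)%E).
  by rewrite integral_itv_bndo_bndc //; apply/measurable_EFinP.
by rewrite (cvg_unique _ cv cv').
Qed.
End substitution.

Section elliptic.
Context {R : realType}.
Notation mu := (@lebesgue_measure R).
Implicit Types (a x z w t : R) (f g : R -> R).

Local Notation quarter f := (\int[mu]_(t in `[0, pi / 2]) f t).

Lemma le_quarter f g : continuous f -> continuous g ->
  (forall t, 0 <= t <= pi / 2 -> f t <= g t) -> quarter f <= quarter g.
Proof.
move=> cf cg fg; apply: le_Rintegral => //; try exact: continuous_integrable.
Qed.

Lemma quarterFTC F f : continuous f ->
  (forall t, has_deriv F t (f t)) -> quarter f = F (pi / 2) - F 0.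
Proof.
move=> cf F'; rewrite -oriented_integral_ge0E ?divr_ge0 ?pi_ge0//.
exact: oriented_integralFTC.
Qed.

Lemma continuous_has_deriv f (d : R -> R) :
  (forall t, has_deriv f t (d t)) -> continuous f.
Proof. by move=> h t; exact: has_deriv_continuous (h t). Qed.

(** Jacobi's delta amplitude. *)
Definition Delta z t := Num.sqrt (1 - z ^+ 2 * sin t ^+ 2).

Lemma Delta_radicand_ge z t : z ^+ 2 < 1 ->
  1 - z ^+ 2 <= 1 - z ^+ 2 * sin t ^+ 2.
Proof.
move=> z1; have := cos2Dsin2 t; have := sqr_ge0 (cos t); have := sqr_ge0 z.
nra.
Qed.

Lemma Delta_radicand_gt0 z t : z ^+ 2 < 1 -> 0 < 1 - z ^+ 2 * sin t ^+ 2.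
Proof. by move=> z1; have := Delta_radicand_ge t z1; lra. Qed.

Lemma Delta_gt0 z t : z ^+ 2 < 1 -> 0 < Delta z t.
Proof. by move=> z1; rewrite sqrtr_gt0 Delta_radicand_gt0. Qed.

Lemma Delta_neq0 z t : z ^+ 2 < 1 -> Delta z t != 0.
Proof. by move=> z1; rewrite gt_eqF// Delta_gt0. Qed.

Lemma sqr_Delta z t : z ^+ 2 < 1 -> Delta z t ^+ 2 = 1 - z ^+ 2 * sin t ^+ 2.
Proof. by move=> z1; rewrite sqr_sqrtr// ltW// Delta_radicand_gt0. Qed.

Lemma Delta_le1 z t : Delta z t <= 1.
Proof.
by rewrite -[leRHS]sqrtr1 ler_sqrt// lerBlDr lerDl mulr_ge0// sqr_ge0.
Qed.

Lemma cos_le_Delta z t : z ^+ 2 < 1 -> cos t <= Delta z t.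
Proof.
move=> z1; have D0 := Delta_gt0 t z1; have := sqr_Delta t z1.
have := cos2Dsin2 t; have := sqr_ge0 (sin t); nra.
Qed.

Lemma Delta_ge z t : z ^+ 2 < 1 -> Num.sqrt (1 - z ^+ 2) <= Delta z t.
Proof.
by move=> z1; rewrite ler_sqrt ?Delta_radicand_ge// ltW// Delta_radicand_gt0.
Qed.

Lemma has_deriv_Delta z t : z ^+ 2 < 1 ->
  has_deriv (Delta z) t (- z ^+ 2 * sin t * cos t / Delta z t).
Proof.
move=> z1; have D0 := Delta_neq0 t z1; rewrite /Delta; derive.
  exact: Delta_radicand_gt0.
by rewrite -/(Delta z t); field.
Qed.

Lemma continuous_Delta z : z ^+ 2 < 1 -> continuous (Delta z).
Proof.
by move=> z1; apply: continuous_has_deriv => t; exact: has_deriv_Delta.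
Qed.

Lemma continuous_DeltaV z : z ^+ 2 < 1 -> continuous (fun t => (Delta z t)^-1).
Proof.
by move=> z1 t; apply: cvgV; [exact: Delta_neq0|exact: continuous_Delta].
Qed.

Definition g_integrand z t := z ^+ 2 * cos t ^+ 2 / Delta z t.

Lemma continuous_g_integrand z : z ^+ 2 < 1 -> continuous (g_integrand z).
Proof.
move=> z1 t; apply: cvgM; last exact: continuous_DeltaV.
apply: (has_deriv_continuous (f := fun t => z ^+ 2 * cos t ^+ 2)).
by derive.
Qed.

Lemma radicand_gt0 z x : z ^+ 2 < 1 -> -1 < x < 1 -> 0 < 1 - z ^+ 2 * x ^+ 2.
Proof.
move=> z1 x1; have x2 : x ^+ 2 < 1 by nra.
by have := sqr_ge0 z; have := sqr_ge0 x; nra.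
Qed.

Lemma continuous_radicand z x : z ^+ 2 < 1 -> -1 < x < 1 ->
  {for x, continuous (fun x => Num.sqrt (1 - z ^+ 2 * x ^+ 2))}.
Proof.
move=> z1 x1.
apply: (has_deriv_continuous (f := fun x => Num.sqrt (1 - z ^+ 2 * x ^+ 2))).
by derive; [exact: radicand_gt0|reflexivity].
Qed.

Lemma ellipticK_trig z : z ^+ 2 < 1 ->
  ellipticK z = quarter (fun t => (Delta z t)^-1).
Proof.
move=> z1.
rewrite -(@integral_sin_substitution _
  (fun x => (Num.sqrt (1 - z ^+ 2 * x ^+ 2))^-1)).
- apply: eq_Rintegral => x /set_mem /=; rewrite in_itv/= => /andP[x0 x1].
  by rewrite sqrtrM ?invfM 1?mulrC//; nra.
- by move=> x; rewrite invr_ge0 sqrtr_ge0.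
- move=> x x1; apply: cvgV; last exact: continuous_radicand.
  by rewrite gt_eqF// sqrtr_gt0 radicand_gt0.
- exact: continuous_DeltaV.
Qed.

Lemma ellipticE_trig z : z ^+ 2 < 1 -> ellipticE z = quarter (Delta z).
Proof.
move=> z1.
rewrite -(@integral_sin_substitution _
  (fun x => Num.sqrt (1 - z ^+ 2 * x ^+ 2)))//.
- by move=> x; exact: continuous_radicand.
- exact: continuous_Delta.
Qed.

(** Minus the bracket in the closed form of the renormalized area. Unlike
    [ellipticK], it stays bounded as the modulus tends to [1]. *)
Definition ellipticG z := ellipticE z - (1 - z ^+ 2) * ellipticK z.

Lemma ellipticG_trig z : z ^+ 2 < 1 -> ellipticG z = quarter (g_integrand z).
Proof.
move=> z1; rewrite /ellipticG ellipticE_trig// ellipticK_trig//.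
rewrite -RintegralZl//; last exact/continuous_integrable/continuous_DeltaV.
rewrite -RintegralB//; last 2 first.
- exact/continuous_integrable/continuous_Delta.
- apply: continuous_integrable => t; apply: cvgM; first exact: cvg_cst.
  exact: continuous_DeltaV.
apply: eq_Rintegral => t _; have D0 := Delta_neq0 t z1.
have e := sqr_Delta t z1.
rewrite /g_integrand.
apply: (mulIf D0); rewrite mulrBl !mulfVK//.
by rewrite -expr2 e sin2cos2; ring.
Qed.

Lemma quarter_cst a : quarter (fun=> a) = a * (pi / 2).
Proof.
rewrite (@quarterFTC (fun t => a * t)); first by rewrite mulr0 subr0.
  exact: cst_continuous.
by move=> t; derive; ring.
Qed.

Lemma quarter_cos : quarter cos = 1.
Proof.
rewrite (@quarterFTC sin); first by rewrite sin_pihalf sin0 subr0.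
  exact: continuous_cos.
by move=> t; exact: is_derive_sin.
Qed.

Lemma continuous_cos2 a : continuous (fun t : R => a * cos t ^+ 2).
Proof. by apply: continuous_has_deriv => t; derive. Qed.

Lemma quarter_cos2 a : quarter (fun t => a * cos t ^+ 2) = a * (pi / 4).
Proof.
rewrite (@quarterFTC (fun t => a * (t + sin t * cos t) / 2)).
- by rewrite sin0 cos_pihalf !(mul0r, mulr0, addr0, subr0); field.
- exact: continuous_cos2.
- by move=> t; derive; have := sin2cos2 t => e; field: e.
Qed.

Lemma ellipticE_ge1 z : z ^+ 2 < 1 -> 1 <= ellipticE z.
Proof.
move=> z1; rewrite ellipticE_trig// -[leLHS]quarter_cos; apply: le_quarter.
- exact: continuous_cos.
- exact: continuous_Delta.
- by move=> t _; exact: cos_le_Delta.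
Qed.

Lemma ellipticE_le z : z ^+ 2 < 1 -> ellipticE z <= pi / 2.
Proof.
move=> z1; rewrite ellipticE_trig//.
apply: (@le_trans _ _ (quarter (fun=> 1))); last by rewrite quarter_cst mul1r.
apply: le_quarter.
- exact: continuous_Delta.
- exact: cst_continuous.
- by move=> t _; exact: Delta_le1.
Qed.

Lemma ellipticK_le z : z ^+ 2 < 1 ->
  ellipticK z <= (Num.sqrt (1 - z ^+ 2))^-1 * (pi / 2).
Proof.
move=> z1; rewrite ellipticK_trig// -quarter_cst; apply: le_quarter.
- exact: continuous_DeltaV.
- exact: cst_continuous.
- move=> t _.
  by rewrite lef_pV2 ?posrE ?Delta_gt0 ?sqrtr_gt0 ?subr_gt0// Delta_ge.
Qed.

Lemma ellipticG_le1 z : z ^+ 2 < 1 -> ellipticG z <= 1.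
Proof.
move=> z1; rewrite ellipticG_trig// -[leRHS]quarter_cos; apply: le_quarter.
- exact: continuous_g_integrand.
- exact: continuous_cos.
- move=> t t1; rewrite /g_integrand ler_pdivrMr ?Delta_gt0//.
  have c0 : 0 <= cos t by apply: cos_ge0_pihalf; lra.
  have cD := cos_le_Delta t z1; have := sqr_ge0 z.
  have := mulr_ge0 c0 c0; nra.
Qed.

(** Together with [ellipticG_le1], this gives the limit [1] at [z = 1]. *)
Lemma ellipticG_ge z : z ^+ 2 < 1 ->
  1 - Num.sqrt (1 - z ^+ 2) * (pi / 2) <= ellipticG z.
Proof.
move=> z1; have := ellipticE_ge1 z1; have := ellipticK_le z1; rewrite /ellipticG.
have s0 : 0 < Num.sqrt (1 - z ^+ 2) by rewrite sqrtr_gt0; lra.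
have : 1 - z ^+ 2 = Num.sqrt (1 - z ^+ 2) ^+ 2 by rewrite sqr_sqrtr; lra.
set s := Num.sqrt _ in s0 * => -> Ks E1.
suff : s ^+ 2 * ellipticK z <= s * (pi / 2) by lra.
by move: Ks; rewrite expr2 -mulrA ler_pM2l// ler_pdivlMl.
Qed.

(** [Delta z t] is at most [1], so the integrand is at least
    [z ^+ 2 * cos t ^+ 2]. *)
Lemma ellipticG_ge_quarter_pi z : z ^+ 2 < 1 -> z ^+ 2 * (pi / 4) <= ellipticG z.
Proof.
move=> z1; rewrite ellipticG_trig// -quarter_cos2; apply: le_quarter.
- exact: continuous_cos2.
- exact: continuous_g_integrand.
- move=> t _; apply: ler_peMr; first by rewrite mulr_ge0 ?sqr_ge0.
  by rewrite invf_ge1 ?Delta_gt0// Delta_le1.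
Qed.
End elliptic.

(** * The derivative in the modulus, and the critical modulus *)

Section modulus.
Context {R : realType}.
Notation mu := (@lebesgue_measure R).
Implicit Types (a x z w t : R) (f g : R -> R).

Local Notation quarter f := (\int[mu]_(t in `[0, pi / 2]) f t).

Lemma sqr_lt1 z : 0 <= z < 1 -> z ^+ 2 < 1.
Proof. by move=> z1; nra. Qed.

Lemma continuous_K2E z : z ^+ 2 < 1 ->
  continuous (fun t => (Delta z t)^-1 - 2 * Delta z t).
Proof.
move=> z1 t; apply: cvgB; first exact: continuous_DeltaV.
by apply: cvgM; [exact: cvg_cst|exact: continuous_Delta].
Qed.

Lemma K2E_trig z : z ^+ 2 < 1 -> ellipticK z - 2 * ellipticE z =
  quarter (fun t => (Delta z t)^-1 - 2 * Delta z t).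
Proof.
move=> z1; rewrite ellipticE_trig// ellipticK_trig//.
have cD := continuous_Delta z1.
rewrite -RintegralZl//; last exact: continuous_integrable.
rewrite -RintegralB//; first exact/continuous_integrable/continuous_DeltaV.
apply: continuous_integrable => t.
by apply: cvgM; [exact: cvg_cst|exact: cD].
Qed.

(** The difference of the two sides is at least the integral of
    [(w ^+ 2 - z ^+ 2) * sin t ^+ 2], which makes the monotonicity strict. *)
Lemma K2E_lt z w : 0 <= z -> z < w -> w < 1 ->
  ellipticK z - 2 * ellipticE z < ellipticK w - 2 * ellipticE w.
Proof.
move=> z0 zw w1; have z1 : z ^+ 2 < 1 by apply: sqr_lt1; lra.
have w1' : w ^+ 2 < 1 by apply: sqr_lt1; lra.
have zw2 : 0 < w ^+ 2 - z ^+ 2 by nra.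
pose gap t : R := (w ^+ 2 - z ^+ 2) - (w ^+ 2 - z ^+ 2) * cos t ^+ 2.
have cgap : continuous gap.
  by apply: continuous_has_deriv => t; rewrite /gap; derive.
have gapE : quarter gap = (w ^+ 2 - z ^+ 2) * (pi / 4).
  rewrite RintegralB//; last 2 first.
  - exact/continuous_integrable/cst_continuous.
  - exact/continuous_integrable/continuous_cos2.
  by rewrite quarter_cst quarter_cos2; field.
have gap0 : 0 < quarter gap by rewrite gapE mulr_gt0// divr_gt0// pi_gt0.
rewrite !K2E_trig// -subr_gt0 (lt_le_trans gap0)//.
rewrite -RintegralB//; try exact/continuous_integrable/continuous_K2E.
apply: le_quarter => //.
  by move=> t; apply: cvgB; apply: continuous_K2E.
move=> t _; rewrite /gap.
have Dw := Delta_gt0 t w1'; have Dz := Delta_gt0 t z1.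
have ew := sqr_Delta t w1'; have ez := sqr_Delta t z1.
have Dz1 := Delta_le1 z t; have Dw1 := Delta_le1 w t.
have s2 := sin2cos2 t; have s0 := sqr_ge0 (sin t).
have Dwz : Delta w t <= Delta z t.
  rewrite -ler_sqr ?nnegrE ?(ltW Dw) ?(ltW Dz)// ew ez lerD2l lerN2 ler_wpM2r//.
  by rewrite ltW// -subr_gt0.
have : (Delta z t)^-1 <= (Delta w t)^-1 by rewrite lef_pV2.
have : (w ^+ 2 - z ^+ 2) - (w ^+ 2 - z ^+ 2) * cos t ^+ 2 =
  (Delta z t - Delta w t) * (Delta z t + Delta w t).
  by rewrite -subr_sqr ew ez s2; ring.
by move=> ->; nra.
Qed.

(** When [2 * z ^+ 2 = 1], the integrand of [2 * ellipticE z - ellipticK z] is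
    [cos t ^+ 2 / Delta z t]. *)
Lemma K2E_low :
  ellipticK (Num.sqrt 2 / 2) < 2 * ellipticE (Num.sqrt 2 / 2) :> R.
Proof.
have z2 : (Num.sqrt 2 / 2 : R) ^+ 2 = 1 / 2.
  by rewrite expr_div_n sqr_sqrtr//; field.
set z := Num.sqrt 2 / 2 in z2 *; have z1 : z ^+ 2 < 1 by rewrite z2; lra.
rewrite -subr_lt0 K2E_trig// -oppr_gt0.
have -> : - quarter (fun t => (Delta z t)^-1 - 2 * Delta z t) =
          quarter (fun t => -1 * ((Delta z t)^-1 - 2 * Delta z t)).
  by rewrite RintegralZl ?mulN1r//; exact/continuous_integrable/continuous_K2E.
have : quarter (fun t => 1 * cos t ^+ 2) <=
       quarter (fun t => -1 * ((Delta z t)^-1 - 2 * Delta z t)).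
  apply: le_quarter; first exact: continuous_cos2.
    move=> t; apply: cvgM; first exact: cvg_cst.
    exact: continuous_K2E.
  move=> t _; have D0 := Delta_gt0 t z1; have e := sqr_Delta t z1.
  have D1 := Delta_le1 z t.
  have -> : 1 * cos t ^+ 2 = 2 * Delta z t ^+ 2 - 1.
    by rewrite e z2 sin2cos2; field.
  have -> : -1 * ((Delta z t)^-1 - 2 * Delta z t) =
    (2 * Delta z t ^+ 2 - 1) / Delta z t by field; rewrite gt_eqF.
  apply: ler_peMr; last by rewrite invf_ge1.
  by rewrite e z2; have := sin2cos2 t; have := sqr_ge0 (cos t); lra.
by apply: lt_le_trans; rewrite quarter_cos2 mul1r divr_gt0// pi_gt0.
Qed.

(** Near [1] the integrand dominates [cos t / (2 * (1 - z * sin t))], whose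
    integral diverges logarithmically. *)
Lemma ellipticK_ge_ln z : 0 < z < 1 -> - ln (1 - z) / 2 <= ellipticK z.
Proof.
move=> /andP[z0 z1]; have z21 : z ^+ 2 < 1 by apply: sqr_lt1; lra.
have sz t : 0 < 1 - z * sin t by have := sin_le1 t; nra.
have sz' t : 0 < 1 + z * sin t by have := sin_geN1 t; nra.
pose f t := cos t / (2 * (1 - z * sin t)).
have cf : continuous f.
  apply: continuous_has_deriv => t; rewrite /f; derive; last reflexivity.
  by rewrite mulf_neq0// gt_eqF.
have fE : quarter f = - ln (1 - z) / (2 * z).
  rewrite (@quarterFTC _ (fun t => - (ln (1 - z * sin t) / (2 * z)))) //.
    by rewrite sin_pihalf sin0 mulr1 mulr0 subr0 ln1 mul0r oppr0 subr0 mulNr.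
  move=> t; rewrite /f; derive => //.
  by field; rewrite ?gt_eqF ?mulr_gt0 ?andbT.
rewrite ellipticK_trig//; apply: (@le_trans _ _ (quarter f)).
  rewrite fE; have l0 : 0 <= - ln (1 - z) by rewrite oppr_ge0 ln_le0//; lra.
  by rewrite ler_wpM2l// lef_pV2 ?posrE//; lra.
apply: le_quarter => //; first exact: continuous_DeltaV.
move=> t t1; have D0 := Delta_gt0 t z21; have e := sqr_Delta t z21.
have c0 : 0 <= cos t by apply: cos_ge0_pihalf; lra.
have cD := cos_le_Delta t z21; have s1 := sin_le1 t.
rewrite /f ler_pdivrMr ?mulr_gt0// mulrC ler_pdivlMr//.
have -> : 2 * (1 - z * sin t) = Delta z t ^+ 2 + (1 - z * sin t) ^+ 2.
  by rewrite e; ring.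
apply: (@le_trans _ _ (Delta z t ^+ 2)); first by nra.
by rewrite lerDl sqr_ge0.
Qed.

Lemma K2E_high : exists2 z : R, Num.sqrt 2 / 2 < z < 1 &
  2 * ellipticE z < ellipticK z.
Proof.
(* Then [ellipticK z >= 9 / 2], while [2 * ellipticE z <= pi < 4]. *)
pose z : R := 1 - expR (-9).
have e0 : 0 < expR (-9) :> R by exact: expR_gt0.
have e1 : expR (-9) <= 1 / 10 :> R.
  rewrite expRN div1r lef_pV2 ?posrE ?expR_gt0//.
  by have := @expR_ge1Dx R 9; lra.
have s2 : Num.sqrt 2 < 3 / 2 :> R.
  by rewrite -[ltRHS]ger0_norm// -sqrtr_sqr ltr_sqrt; lra.
have z1 : 0 < z < 1 by rewrite /z; lra.
exists z; first by rewrite /z; lra.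
apply: (lt_le_trans _ (ellipticK_ge_ln z1)).
have -> : ln (1 - z) = -9 by rewrite /z opprB addrC subrK expRK.
have z21 : z ^+ 2 < 1 by apply: sqr_lt1; lra.
have := ellipticE_le z21; have := @pihalf_lt2 R; lra.
Qed.
End modulus.

Section modulus_derivative.
Context {R : realType}.
Notation mu := (@lebesgue_measure R).
Implicit Types (a x z w t : R) (f g : R -> R).

Local Notation quarter f := (\int[mu]_(t in `[0, pi / 2]) f t).

Let mid z : 0 < z < 1 -> 0 < z < (z + 1) / 2 /\ (z + 1) / 2 < 1.
Proof. by move=> z1; split; lra. Qed.

(** On a neighborhood of [z] away from [1], [Delta] has a positive lower
    bound independent of the modulus, which gives the dominating constants. *)
Let Delta_lbound v w t : 0 < w < v -> v < 1 ->
  Num.sqrt (1 - v ^+ 2) <= Delta w t.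
Proof.
move=> wv v1; have w1 : w ^+ 2 < 1 by apply: sqr_lt1; lra.
by apply: le_trans (Delta_ge t w1); rewrite ler_sqrt; nra.
Qed.

Lemma has_deriv_Delta_modulus z t : z ^+ 2 < 1 ->
  has_deriv (Delta ^~ t) z (- z * sin t ^+ 2 / Delta z t).
Proof.
move=> z1; have D0 := Delta_neq0 t z1; rewrite /Delta; derive.
  exact: Delta_radicand_gt0.
by rewrite -/(Delta z t); field.
Qed.

Lemma has_deriv_g_modulus z t : z ^+ 2 < 1 ->
  has_deriv (g_integrand ^~ t) z
    (z * cos t ^+ 2 * (1 + Delta z t ^+ 2) / Delta z t ^+ 3).
Proof.
move=> z1; have D0 := Delta_neq0 t z1; rewrite /g_integrand.
apply: has_deriv_eq.
  apply: has_derivM; first by derive.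
  by apply: has_derivV => //; exact: has_deriv_Delta_modulus.
have s2 : z ^+ 2 * sin t ^+ 2 = 1 - Delta z t ^+ 2 by rewrite sqr_Delta//; ring.
rewrite [in RHS](_ : 1 + Delta z t ^+ 2 =
    2 * Delta z t ^+ 2 + z ^+ 2 * sin t ^+ 2).
  by field.
by rewrite s2; ring.
Qed.

(** Up to the derivative in [t] of a function vanishing at both ends of the
    quarter period, the derivative of the integrand in the modulus is the
    integrand of [z * ellipticK z]. *)
Lemma quarter_dg z : z ^+ 2 < 1 ->
  quarter (fun t => z * cos t ^+ 2 * (1 + Delta z t ^+ 2) / Delta z t ^+ 3) =
  z * ellipticK z.
Proof.
move=> z1; rewrite ellipticK_trig//.
have cDV := continuous_DeltaV z1.
rewrite -RintegralZl//; last exact: continuous_integrable.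
pose F t := z * (sin t * cos t / Delta z t).
pose f t := z * (cos t ^+ 2 - sin t ^+ 2
  + z ^+ 2 * sin t ^+ 2 * cos t ^+ 2 / Delta z t ^+ 2) / Delta z t.
have F' t : has_deriv F t (f t).
  have D0 := Delta_neq0 t z1; rewrite /F; apply: has_deriv_eq.
    apply: has_derivM; first exact: has_deriv_cst.
    apply: has_derivM; first by derive.
    by apply: has_derivV => //; exact: has_deriv_Delta.
  by rewrite /f; field.
have cf : continuous f.
  apply: (continuous_has_deriv (d := fun t => _)) => t.
  have D0 := Delta_neq0 t z1; rewrite /f.
  apply: has_derivM; last by apply: has_derivV => //; exact: has_deriv_Delta.
  apply: has_derivM; first exact: has_deriv_cst.
  apply: has_derivD; first by derive_rules.
  apply: has_derivM; first by derive_rules.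
  apply: has_derivV; first by rewrite expf_neq0.
  by apply: has_derivX; exact: has_deriv_Delta.
have czD : continuous (fun t => z * (Delta z t)^-1).
  by move=> t; apply: cvgM; [exact: cvg_cst|exact: cDV].
have F0 : quarter f = 0.
  by rewrite (quarterFTC cf F') /F sin0 cos_pihalf !(mulr0, mul0r) subrr.
transitivity (quarter (fun t => z * (Delta z t)^-1) + quarter f); last first.
  by rewrite F0 addr0.
rewrite -RintegralD//; try exact: continuous_integrable.
apply: eq_Rintegral => t _; have D0 := Delta_neq0 t z1.
have s2 : z ^+ 2 * sin t ^+ 2 = 1 - Delta z t ^+ 2 by rewrite sqr_Delta//; ring.
by rewrite /f s2 sin2cos2; field.
Qed.

(** Differentiation under the integral sign, dominated by the constant
    [2 / s ^+ 3] with [s] a lower bound of [Delta] near [z]. *)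
Lemma has_deriv_ellipticG z : 0 < z < 1 ->
  has_deriv ellipticG z (z * ellipticK z).
Proof.
move=> z01; have [zv v1] := mid z01; set v := (z + 1) / 2 in zv v1.
have z21 : z ^+ 2 < 1 by apply: sqr_lt1; lra.
have w21 w : w \in `]0, v[ -> w ^+ 2 < 1.
  by rewrite in_itv/= => ?; apply: sqr_lt1; lra.
have Iz : (`]0, v[%classic : set R) z by rewrite /= in_itv/=; lra.
set s := Num.sqrt (1 - v ^+ 2).
have s0 : 0 < s by rewrite sqrtr_gt0; nra.
have intf w : (`]0, v[%classic : set R) w ->
    mu.-integrable `[0, pi / 2] (EFin \o g_integrand w).
  by move=> /w21 w1; apply: continuous_integrable; exact: continuous_g_integrand.
have d1 w t : (`]0, v[%classic : set R) w -> `[0, pi / 2]%classic t ->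
    derivable (g_integrand ^~ t) w 1.
  move=> /w21 w1 _; have h := has_deriv_g_modulus t w1.
  exact: (@ex_derive _ _ _ _ _ _ _ h).
have ub w t : (`]0, v[%classic : set R) w -> `[0, pi / 2]%classic t ->
    `|partial1of2 g_integrand w t| <= cst (2 / s ^+ 3) t.
  move=> Iw _; have w1 := w21 _ Iw; move: Iw; rewrite /= in_itv/= => wv.
  rewrite /partial1of2 (has_deriv_derive1 (has_deriv_g_modulus t w1)).
  have D0 := Delta_gt0 t w1; have D1 := Delta_le1 w t.
  have sD := Delta_lbound t wv v1.
  have c1 : cos t ^+ 2 <= 1 by have := cos2Dsin2 t; have := sqr_ge0 (sin t); lra.
  have c0 := sqr_ge0 (cos t).
  rewrite ger0_norm; last first.
    rewrite divr_ge0 ?exprn_ge0 ?(ltW D0)// mulr_ge0 ?addr_ge0 ?sqr_ge0//.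
    by rewrite mulr_ge0//; lra.
  apply: ler_pM.
  - by apply: mulr_ge0; [apply: mulr_ge0 => //; lra|rewrite addr_ge0// sqr_ge0].
  - by rewrite invr_ge0 exprn_ge0// ltW.
  - have a1 : w * cos t ^+ 2 <= 1 by nra.
    have a0 : 0 <= w * cos t ^+ 2 by nra.
    have b1 : 1 + Delta w t ^+ 2 <= 2 by nra.
    have b0 := sqr_ge0 (Delta w t).
    by nra.
  - by rewrite lef_pV2 ?posrE ?exprn_gt0// lerXn2r// ?nnegrE ltW.
have G0 t : 0 <= (cst (2 / s ^+ 3) : R -> R) t.
  by rewrite divr_ge0// exprn_ge0// ltW.
have intG : mu.-integrable `[0, pi / 2] (EFin \o cst (2 / s ^+ 3)).
  exact/continuous_integrable/cst_continuous.
pose H w := quarter (g_integrand w).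
have dH : has_deriv H z (z * ellipticK z).
  apply: DeriveDef.
    exact: (@derivable_under_integral _ _ _ mu g_integrand _ (measurable_itv _)
      z 0 v Iz intf d1 _ G0 intG ub).
  rewrite -derive1E.
  rewrite (@differentiation_under_integral _ _ _ mu g_integrand _
      (measurable_itv _) z 0 v Iz intf d1 _ G0 intG ub).
  rewrite -quarter_dg//; apply: eq_Rintegral => t _.
  by rewrite /partial1of2 (has_deriv_derive1 (has_deriv_g_modulus t z21)).
apply: near_eq_is_derive dH.
have : \forall w \near z, w \in `]0, v[.
  by apply: near_in_itvoo; rewrite in_itv/=; lra.
by apply: filterS => w /w21 w1; rewrite /H ellipticG_trig.
Qed.

Lemma continuous_ellipticK z : 0 < z < 1 -> {for z, continuous (@ellipticK R)}.
Proof.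
move=> z01; have [zv v1] := mid z01; set v := (z + 1) / 2 in zv v1.
have w21 w : w \in `]0, v[ -> w ^+ 2 < 1.
  by rewrite in_itv/= => ?; apply: sqr_lt1; lra.
set s := Num.sqrt (1 - v ^+ 2).
have s0 : 0 < s by rewrite sqrtr_gt0; nra.
pose f w t := (Delta w t)^-1.
have cH : {in (`]0, v[%classic : set R), continuous (fun w => quarter (f w))}.
  apply: (@continuity_under_integral R _ _ mu f `[0, pi / 2]%classic _ 0 v _ _
    (cst s^-1)) => //.
  - move=> w /w21 w1; exact/continuous_integrable/continuous_DeltaV.
  - apply: aeW => t _ w /set_mem/w21 w1.
    apply: cvgV; first exact: Delta_neq0.
    exact: has_deriv_continuous (has_deriv_Delta_modulus t w1).
  - exact/continuous_integrable/cst_continuous.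
  - move=> w Iw; apply: aeW => t _; have w1 := w21 _ Iw.
    move: Iw; rewrite /= in_itv/= => wv.
    have D0 := Delta_gt0 t w1; rewrite /f ger0_norm ?invr_ge0 ?(ltW D0)//.
    by rewrite lef_pV2 ?posrE// Delta_lbound.
have Iz : z \in `]0, v[ by rewrite in_itv/=; lra.
have := cH z (mem_set Iz).
rewrite /continuous_at -ellipticK_trig; last exact: w21.
apply: cvg_trans; apply: near_eq_cvg.
have : \forall w \near z, w \in `]0, v[ by apply: near_in_itvoo.
by apply: filterS => w /w21 w1; rewrite ellipticK_trig.
Qed.

Lemma continuous_ellipticE z : 0 < z < 1 -> {for z, continuous (@ellipticE R)}.
Proof.
move=> z01.
have -> : @ellipticE R = (fun z => ellipticG z + (1 - z ^+ 2) * ellipticK z).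
  by apply/funext => w; rewrite /ellipticG subrK.
apply: cvgD; first exact: has_deriv_continuous (has_deriv_ellipticG z01).
apply: cvgM; last exact: continuous_ellipticK.
apply: (has_deriv_continuous (f := fun z => 1 - z ^+ 2)).
by derive.
Qed.

Lemma critical_modulus_exists : exists2 zp : R, Num.sqrt 2 / 2 < zp < 1 &
  ellipticK zp = 2 * ellipticE zp.
Proof.
have [z1 /andP[z1l z1r] z1K] := @K2E_high R.
have s2 : 0 < Num.sqrt 2 :> R by rewrite sqrtr_gt0.
pose f z : R := ellipticK z - 2 * ellipticE z.
have cf : {within `[Num.sqrt 2 / 2, z1], continuous f}.
  apply: continuous_in_subspaceT => z /set_mem; rewrite /= in_itv/= => zI.
  have z01 : 0 < z < 1 by lra.
  apply: cvgB; first exact: continuous_ellipticK.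
  by apply: cvgM; [exact: cvg_cst|exact: continuous_ellipticE].
have lo : f (Num.sqrt 2 / 2) < 0 by rewrite subr_lt0 K2E_low.
have hi : 0 < f z1 by rewrite subr_gt0.
have [|z zI fz] := @IVT _ f _ _ 0 (ltW z1l) cf.
  by rewrite ge_min le_max (ltW lo) (ltW hi) orbT.
exists z; last by apply/eqP; rewrite -subr_eq0 -/(f z) fz.
move: zI; rewrite in_itv/= => /andP[zl zr]; rewrite (le_lt_trans zr z1r) andbT.
rewrite lt_neqAle zl andbT; apply: contraTneq lo => ->.
by rewrite fz ltxx.
Qed.
End modulus_derivative.

(** * The induced metric of the catenoid *)

Section hyperbolic_functions.
Context {R : realType}.
Implicit Types x y : R.

Lemma expR_mulN x : expR x * expR (- x) = 1 :> R.
Proof. by rewrite -expRD subrr expR0. Qed.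

Lemma cosh_sq x : cosh x ^+ 2 = 1 + sinh x ^+ 2.
Proof. by have e := expR_mulN x; rewrite /cosh /sinh; field: e. Qed.

Lemma cosh_double x : cosh (2 * x) = 2 * cosh x ^+ 2 - 1.
Proof.
have -> : 2 * x = x + x by ring.
rewrite /cosh opprD !expRD.
by have e := expR_mulN x; field: e.
Qed.

Lemma cosh_ge1 x : 1 <= cosh x.
Proof.
have e := expR_mulN x; have a := expR_gt0 x; have b := expR_gt0 (- x).
rewrite /cosh ler_pdivlMr//; have := sqr_ge0 (expR x - expR (- x)); nra.
Qed.

Lemma cosh_gt0 x : 0 < cosh x.
Proof. exact: lt_le_trans (cosh_ge1 x). Qed.

Lemma coshN x : cosh (- x) = cosh x.
Proof. by rewrite /cosh opprK addrC. Qed.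

Lemma sinh_gt0 x : 0 < x -> 0 < sinh x.
Proof.
by move=> x0; rewrite /sinh divr_gt0// subr_gt0 ltr_expR; lra.
Qed.

Lemma sinh0 : sinh 0 = 0 :> R.
Proof. by rewrite /sinh oppr0 subrr mul0r. Qed.

Lemma ltr_cosh x y : 0 <= x -> x < y -> cosh x < cosh y.
Proof.
move=> x0 xy; apply: (@has_deriv_gt0_lt _ _ _ _ (@sinh R)) => // z zI.
  by derive; rewrite mulr1.
by apply: sinh_gt0; lra.
Qed.

Lemma ler_cosh x y : 0 <= x -> x <= y -> cosh x <= cosh y.
Proof.
by move=> x0; rewrite le_eqVlt => /predU1P[->//|xy]; exact/ltW/ltr_cosh.
Qed.

End hyperbolic_functions.

Section metric.
Context {R : realType} (c : R) (c0 : 0 < c).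
Implicit Types s t : R.

(** Square root of the discriminant of [- u ^+ 2 + c ^+ 2 * u + 1]. *)
Definition disc : R := Num.sqrt (c ^+ 4 + 4).

Lemma sqr_disc : disc ^+ 2 = c ^+ 4 + 4.
Proof. by rewrite sqr_sqrtr// addr_ge0// exprn_ge0// ltW. Qed.

Lemma disc_gt : c ^+ 2 < disc.
Proof.
have d0 : 0 <= disc by exact: sqrtr_ge0.
rewrite -ltr_sqr ?nnegrE// ?exprn_ge0 ?(ltW c0)// sqr_disc -exprM.
by rewrite ltrDl.
Qed.

Lemma disc_gt0 : 0 < disc.
Proof. by apply: le_lt_trans disc_gt; exact: sqr_ge0. Qed.

(** The reciprocal of [catenoid_u], which is linear in [cosh (2 * s)]; it is
    [c ^+ 2] times the square of [cat_r] below. *)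
Definition cat_q s : R := (disc * cosh (2 * s) - c ^+ 2) / 2.

Lemma cat_q_gt0 s : 0 < cat_q s.
Proof.
rewrite divr_gt0// subr_gt0 (lt_le_trans disc_gt)// ler_peMr// ?cosh_ge1//.
exact/ltW/disc_gt0.
Qed.

Lemma cat_qN s : cat_q (- s) = cat_q s.
Proof. by rewrite /cat_q mulrN coshN. Qed.

Lemma cat_qc_gt0 s : 0 < cat_q s + c ^+ 2.
Proof. by rewrite addr_gt0 ?cat_q_gt0// exprn_gt0. Qed.

Lemma catenoid_uE s : catenoid_u c s = (cat_q s)^-1.
Proof. by rewrite /catenoid_u -/disc /cat_q invf_div. Qed.

Lemma has_deriv_cat_q s : has_deriv cat_q s (disc * sinh (2 * s)).
Proof. by rewrite /cat_q; derive; field. Qed.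

(** The equation [(u')^2 = 4 * u^2 * (- u^2 + c^2 * u + 1)] of the catenoid,
    rewritten for the reciprocal of [u]. *)
Lemma cat_q_energy s : (disc * sinh (2 * s)) ^+ 2 =
  4 * (cat_q s ^+ 2 + c ^+ 2 * cat_q s - 1).
Proof.
have e := cosh_sq (2 * s); have d := sqr_disc.
rewrite exprMn -[sinh _ ^+ 2](addKr 1) -e /cat_q.
have -> : disc ^+ 2 * (- 1 + cosh (2 * s) ^+ 2) =
  (disc * cosh (2 * s)) ^+ 2 - disc ^+ 2 by ring.
by rewrite d; field.
Qed.

(** The radius of the rotation circle in the plane of [x1] and [x2], and the
    quantity [Num.sqrt (1 + cat_r ^+ 2)] that the equation of the hyperboloid
    prescribes for the other two coordinates. *)
Definition cat_r s : R := Num.sqrt (cat_q s) / c.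
Definition cat_w s : R := Num.sqrt (cat_q s + c ^+ 2) / c.

(** Minus the derivative of [catenoid_v], up to the factor [c]. *)
Definition cat_dv s : R := (Num.sqrt (cat_q s) * (cat_q s + c ^+ 2))^-1.

Lemma cat_dv_gt0 s : 0 < cat_dv s.
Proof. by rewrite invr_gt0 mulr_gt0 ?cat_qc_gt0// sqrtr_gt0 cat_q_gt0. Qed.

Lemma catenoid_v_integrandE s :
  catenoid_u c s `^ (3 / 2) / (1 + c ^+ 2 * catenoid_u c s) = cat_dv s.
Proof.
have q0 := cat_q_gt0 s; have qc := cat_qc_gt0 s.
have u0 : 0 < (cat_q s)^-1 by rewrite invr_gt0.
have -> : 3 / 2 = 1 + 2^-1 :> R by field.
rewrite catenoid_uE powRD; last by rewrite (gt_eqF u0) implybT.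
rewrite powRr1 ?ltW// powR12_sqrt ?ltW// sqrtrV ?ltW// /cat_dv.
have sq0 : Num.sqrt (cat_q s) != 0 by rewrite gt_eqF// sqrtr_gt0.
by field; rewrite sq0 !gt_eqF.
Qed.

Lemma continuous_cat_dv : continuous cat_dv.
Proof.
apply: (continuous_has_deriv (d := fun t => _)) => t; rewrite /cat_dv.
apply: has_derivV.
  by rewrite gt_eqF// mulr_gt0 ?cat_qc_gt0// sqrtr_gt0 cat_q_gt0.
apply: has_derivM.
  by apply: has_deriv_sqrt (cat_q_gt0 _) (has_deriv_cat_q _).
by apply: has_derivD; [exact: has_deriv_cat_q|exact: has_deriv_cst].
Qed.

Lemma catenoid_vE s : catenoid_v c s = - c * oriented_integral 0 s cat_dv.
Proof.
by rewrite /catenoid_v; under eq_fun do rewrite catenoid_v_integrandE.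
Qed.

Lemma has_deriv_catenoid_v s : has_deriv (catenoid_v c) s (- c * cat_dv s).
Proof.
have -> : catenoid_v c = (fun s => - c * oriented_integral 0 s cat_dv).
  by apply/funext => y; exact: catenoid_vE.
apply: has_deriv_eq.
  apply: has_derivM; first exact: has_deriv_cst.
  exact: has_deriv_oriented_integral continuous_cat_dv.
by rewrite mulr0 addr0.
Qed.

Lemma has_deriv_cat_r s :
  has_deriv cat_r s (disc * sinh (2 * s) / (2 * Num.sqrt (cat_q s) * c)).
Proof.
have c1 : c != 0 by rewrite gt_eqF.
have q0 : Num.sqrt (cat_q s) != 0 by rewrite gt_eqF// sqrtr_gt0 cat_q_gt0.
rewrite /cat_r; apply: has_deriv_eq.
  apply: has_derivM; last exact: has_deriv_cst.
  by apply: has_deriv_sqrt; [exact: cat_q_gt0|exact: has_deriv_cat_q].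
by cbv beta; field; rewrite q0 c1.
Qed.

Lemma has_deriv_cat_w s :
  has_deriv cat_w s
    (disc * sinh (2 * s) / (2 * Num.sqrt (cat_q s + c ^+ 2) * c)).
Proof.
have c1 : c != 0 by rewrite gt_eqF.
have q0 : Num.sqrt (cat_q s + c ^+ 2) != 0.
  by rewrite gt_eqF// sqrtr_gt0 cat_qc_gt0.
rewrite /cat_w; apply: has_deriv_eq.
  apply: has_derivM; last exact: has_deriv_cst.
  apply: has_deriv_sqrt; first exact: cat_qc_gt0.
  by apply: has_derivD; [exact: has_deriv_cat_q|exact: has_deriv_cst].
by cbv beta; field; rewrite q0 c1.
Qed.

Lemma row4E (a1 a2 a3 a4 : R) :
  let X : 'rV[R]_4 := \row_i [:: a1; a2; a3; a4]`_i in
  [/\ X ord0 x1 = a1, X ord0 x2 = a2, X ord0 x3 = a3 & X ord0 xz = a4].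
Proof. by split; rewrite mxE inordK. Qed.

Lemma catenoid_XE s t :
  [/\ catenoid_X c (s, t) ord0 x1 = cat_r s * cos t,
      catenoid_X c (s, t) ord0 x2 = cat_r s * sin t,
      catenoid_X c (s, t) ord0 x3 = cat_w s * sinh (catenoid_v c s) &
      catenoid_X c (s, t) ord0 xz = cat_w s * cosh (catenoid_v c s)].
Proof.
have q0 := cat_q_gt0 s.
have sq0 : Num.sqrt (cat_q s) != 0 by rewrite gt_eqF ?sqrtr_gt0.
have rE : (c * Num.sqrt (catenoid_u c s))^-1 = cat_r s.
  by rewrite catenoid_uE sqrtrV ?ltW// invf_div.
have wE : cat_r s * Num.sqrt (1 + c ^+ 2 * catenoid_u c s) = cat_w s.
  rewrite catenoid_uE /cat_r /cat_w mulrAC -sqrtrM ?ltW//.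
  by congr (Num.sqrt _ / _); field; rewrite gt_eqF.
have [X1 X2 X3 X4] := row4E (cos t) (sin t)
  (Num.sqrt (1 + c ^+ 2 * catenoid_u c s) * sinh (catenoid_v c s))
  (Num.sqrt (1 + c ^+ 2 * catenoid_u c s) * cosh (catenoid_v c s)).
by split; rewrite /catenoid_X mxE rE ?X1 ?X2 ?X3 ?X4// mulrA wE.
Qed.

Lemma catenoid_partial1 s t :
  [/\ partial1 (catenoid_X c) (s, t) ord0 x1 =
        disc * sinh (2 * s) / (2 * Num.sqrt (cat_q s) * c) * cos t,
      partial1 (catenoid_X c) (s, t) ord0 x2 =
        disc * sinh (2 * s) / (2 * Num.sqrt (cat_q s) * c) * sin t,
      partial1 (catenoid_X c) (s, t) ord0 x3 =
        disc * sinh (2 * s) / (2 * Num.sqrt (cat_q s + c ^+ 2) * c)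
          * sinh (catenoid_v c s)
        - c * cat_dv s * cat_w s * cosh (catenoid_v c s) &
      partial1 (catenoid_X c) (s, t) ord0 xz =
        disc * sinh (2 * s) / (2 * Num.sqrt (cat_q s + c ^+ 2) * c)
          * cosh (catenoid_v c s)
        - c * cat_dv s * cat_w s * sinh (catenoid_v c s)].
Proof.
have X1 : (fun s => catenoid_X c (s, t) ord0 x1) = (fun s => cat_r s * cos t).
  by apply/funext => y; have [] := catenoid_XE y t.
have X2 : (fun s => catenoid_X c (s, t) ord0 x2) = (fun s => cat_r s * sin t).
  by apply/funext => y; have [] := catenoid_XE y t.
have X3 : (fun s => catenoid_X c (s, t) ord0 x3) =
    (fun s => cat_w s * sinh (catenoid_v c s)).
  by apply/funext => y; have [] := catenoid_XE y t.
have X4 : (fun s => catenoid_X c (s, t) ord0 xz) =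
    (fun s => cat_w s * cosh (catenoid_v c s)).
  by apply/funext => y; have [] := catenoid_XE y t.
have dr := has_deriv_cat_r s; have dw := has_deriv_cat_w s.
have dv := has_deriv_catenoid_v s.
split; rewrite mxE /= ?X1 ?X2 ?X3 ?X4; apply: has_deriv_derive1.
- by apply: has_deriv_eq;
    [apply: has_derivM dr (has_deriv_cst _ _)|cbv beta; ring].
- by apply: has_deriv_eq;
    [apply: has_derivM dr (has_deriv_cst _ _)|cbv beta; ring].
- by apply: has_deriv_eq;
    [apply: has_derivM dw (has_deriv_sinh dv)|cbv beta; ring].
- by apply: has_deriv_eq;
    [apply: has_derivM dw (has_deriv_cosh dv)|cbv beta; ring].
Qed.

Lemma catenoid_partial2 s t :
  [/\ partial2 (catenoid_X c) (s, t) ord0 x1 = - cat_r s * sin t,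
      partial2 (catenoid_X c) (s, t) ord0 x2 = cat_r s * cos t,
      partial2 (catenoid_X c) (s, t) ord0 x3 = 0 &
      partial2 (catenoid_X c) (s, t) ord0 xz = 0].
Proof.
have X1 : (fun t => catenoid_X c (s, t) ord0 x1) = (fun t => cat_r s * cos t).
  by apply/funext => y; have [] := catenoid_XE s y.
have X2 : (fun t => catenoid_X c (s, t) ord0 x2) = (fun t => cat_r s * sin t).
  by apply/funext => y; have [] := catenoid_XE s y.
have X3 : (fun t => catenoid_X c (s, t) ord0 x3) =
    (fun=> cat_w s * sinh (catenoid_v c s)).
  by apply/funext => y; have [] := catenoid_XE s y.
have X4 : (fun t => catenoid_X c (s, t) ord0 xz) =
    (fun=> cat_w s * cosh (catenoid_v c s)).
  by apply/funext => y; have [] := catenoid_XE s y.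
split; rewrite mxE /= ?X1 ?X2 ?X3 ?X4; apply: has_deriv_derive1.
- by derive; ring.
- by derive; ring.
- exact: has_deriv_cst.
- exact: has_deriv_cst.
Qed.

(** The parameter [s] is arclength on the profile curve. *)
Lemma catenoid_unit_speed s t :
  lorentz (partial1 (catenoid_X c) (s, t)) (partial1 (catenoid_X c) (s, t)) = 1.
Proof.
have [e1 e2 e3 e4] := catenoid_partial1 s t; rewrite /lorentz e1 e2 e3 e4.
have c1 : c != 0 by rewrite gt_eqF.
have q0 := cat_q_gt0 s; have qc0 := cat_qc_gt0 s.
have Q0 : Num.sqrt (cat_q s) != 0 by rewrite gt_eqF ?sqrtr_gt0.
have W0 : Num.sqrt (cat_q s + c ^+ 2) != 0 by rewrite gt_eqF ?sqrtr_gt0.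
have Q2 : Num.sqrt (cat_q s) ^+ 2 = cat_q s by rewrite sqr_sqrtr ?ltW.
have W2 : Num.sqrt (cat_q s + c ^+ 2) ^+ 2 = cat_q s + c ^+ 2.
  by rewrite sqr_sqrtr ?ltW.
have ch := cosh_sq (catenoid_v c s); have cs := cos2sin2 t.
transitivity ((disc * sinh (2 * s) / (2 * Num.sqrt (cat_q s) * c)) ^+ 2
  - (disc * sinh (2 * s) / (2 * Num.sqrt (cat_q s + c ^+ 2) * c)) ^+ 2
  + (c * cat_dv s * cat_w s) ^+ 2).
  move: (_ / _) (disc * sinh _ / _) (c * _ * _) => A B V.
  by ring: ch cs.
rewrite /cat_dv /cat_w; have en := cat_q_energy s.
clear e1 e2 e3 e4 q0 ch cs.
move: (disc * _) (cat_q s) en qc0 Q0 W0 Q2 W2 => p q en qc0 Q0 W0 Q2 W2.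
rewrite !expr_div_n en !exprMn exprVn exprMn Q2 W2.
have q1 : q != 0 by rewrite -Q2 expf_neq0.
by field; rewrite c1 q1 gt_eqF.
Qed.

(** Rotation circles are orthogonal to the profile curve, which has unit
    speed, so the density is the radius of the circle. *)
Lemma catenoid_area_density s t : area_density (catenoid_X c) (s, t) = cat_r s.
Proof.
(* The coordinate tangent vectors are made opaque: comparing them by conversion
   would unfold the derivatives. *)
rewrite /area_density; have E1 := catenoid_unit_speed s t.
have [e1 e2 _ _] := catenoid_partial1 s t.
have [f1 f2 f3 f4] := catenoid_partial2 s t.
move: (partial1 _ _) (partial2 _ _) E1 e1 e2 f1 f2 f3 f4.
move=> X1 X2 -> e1 e2 f1 f2 f3 f4.
have r0 : 0 <= cat_r s by rewrite divr_ge0 ?sqrtr_ge0// ltW.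
have -> : lorentz X1 X2 = 0.
  by rewrite /lorentz e1 e2 f1 f2 f3 f4; ring.
have -> : lorentz X2 X2 = cat_r s ^+ 2.
  by rewrite /lorentz f1 f2 f3 f4; have e := sin2cos2 t; ring: e.
by rewrite mul1r expr0n subr0 sqrtr_sqr ger0_norm.
Qed.

End metric.

(** * Area of the truncated catenoid *)

Section even_integrals.
Context {R : realType}.
Notation mu := (@lebesgue_measure R).
Implicit Types (f : R -> R) (s : R).

Lemma oriented_integralN f s : continuous f -> (forall t, f (- t) = f t) ->
  oriented_integral 0 (- s) f = - oriented_integral 0 s f.
Proof.
move=> cf fN; pose F t := - oriented_integral 0 (- t) f.
have F' t : has_deriv F t (f t).
  apply: has_deriv_eq.
    apply: has_derivN.
    apply: (has_deriv_comp (f := fun t => oriented_integral 0 t f)).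
      exact: has_deriv_oriented_integral.
    by apply: has_derivN; exact: has_deriv_id.
  by rewrite fN; ring.
rewrite (oriented_integralFTC s cf F') /F oppr0.
by rewrite [oriented_integral 0 0 f]subrr; ring.
Qed.

Lemma Rintegral_even f s : 0 <= s -> continuous f -> (forall t, f (- t) = f t) ->
  \int[mu]_(t in `[- s, s]) f t = 2 * oriented_integral 0 s f.
Proof.
move=> s0 cf fN; have s0' : - s <= 0 by rewrite oppr_le0.
have := @oriented_integralEl _ f (- s) s cf s0' (le_trans s0' s0).
have := @oriented_integralEl _ f (- s) (- s) cf s0' (lexx _).
rewrite oriented_integralN// set_itv1 Rintegral_set1; lra.
Qed.

Lemma oriented_integral_lt f s t : continuous f -> (forall x, 0 < f x) ->
  s < t -> oriented_integral 0 s f < oriented_integral 0 t f.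
Proof.
move=> cf f0 st.
apply: (has_deriv_gt0_lt (f := fun y => oriented_integral 0 y f) (d := f)) => //.
by move=> x _; exact: has_deriv_oriented_integral.
Qed.

End even_integrals.

Section product_domain.
Context {R : realType}.
Notation mu := (@lebesgue_measure R).

Lemma integral_rectangle_fst (f : R -> R) (a b l : R) : continuous f ->
  (forall x, 0 <= f x) -> 0 <= l ->
  (\int[mu \x mu]_(p in `[a, b]%classic `*` `[0%R, l[%classic) (f p.1)%:E =
   (l * \int[mu]_(x in `[a, b]) f x)%:E)%E.
Proof.
move=> cf f0 l0.
set D := _ `*` _.
have mD : measurable D by apply: measurableX; exact: measurable_itv.
have mf : measurable_fun setT (fun p : R * R => (f p.1)%:E).
  apply/measurable_EFinP; apply: measurableT_comp => //.
  exact: continuous_measurable_fun.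
rewrite integral_mkcond fubini_tonelli1; last 2 first.
- by apply/(measurable_restrictT _ mD); apply: measurable_funTS.
- by move=> p; rewrite patchE; case: ifPn => // _; rewrite lee_fin.
transitivity (\int[mu]_(x in `[a, b]) (l * f x)%:E)%E.
  rewrite [RHS]integral_mkcond; apply: eq_integral => x _.
  rewrite /fubini_F patchE; case: ifPn => [xab|xab].
    transitivity (\int[mu]_(y in `[0%R, l[) (f x)%:E)%E.
      rewrite [RHS]integral_mkcond; apply: eq_integral => y _.
      rewrite !patchE; congr (if _ then _ else _).
      by rewrite /D in_setX xab.
    rewrite integral_cst//= lebesgue_measure_itv/= lte_fin.
    move: l0; rewrite le_eqVlt => /predU1P[<-|l0].
      by rewrite ltxx mule0 mul0r.
    by rewrite l0 sube0 mulrC EFinM.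
  rewrite integral0_eq// => y _; rewrite patchE ifN// /D in_setX.
  by rewrite (negPf xab).
have intf : mu.-integrable `[a, b] (EFin \o f) by exact: continuous_integrable.
under eq_integral do rewrite EFinM.
rewrite integralZl// EFinM; congr (_ * _)%E.
by rewrite /Rintegral fineK//; exact: integrable_fin_num.
Qed.

End product_domain.

Section truncation.
Context {R : realType} (c : R) (c0 : 0 < c).
Notation mu := (@lebesgue_measure R).
Implicit Types s t x y : R.

(** The coordinate [z] of the hyperboloid model along the profile curve. *)
Definition cat_z s : R := cat_w c s * cosh (catenoid_v c s).

Lemma cat_dvN s : cat_dv c (- s) = cat_dv c s.
Proof. by rewrite /cat_dv cat_qN. Qed.

Lemma cat_rN s : cat_r c (- s) = cat_r c s.
Proof. by rewrite /cat_r cat_qN. Qed.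

Lemma catenoid_vN s : catenoid_v c (- s) = - catenoid_v c s.
Proof.
by rewrite !catenoid_vE// oriented_integralN ?mulrN//;
  [exact: continuous_cat_dv|exact: cat_dvN].
Qed.

Lemma cat_zN s : cat_z (- s) = cat_z s.
Proof. by rewrite /cat_z catenoid_vN coshN /cat_w cat_qN. Qed.

Lemma cat_w_gt0 s : 0 < cat_w c s.
Proof. by rewrite divr_gt0// sqrtr_gt0 cat_qc_gt0. Qed.

Lemma cat_r_gt0 s : 0 < cat_r c s.
Proof. by rewrite divr_gt0// sqrtr_gt0 cat_q_gt0. Qed.

Lemma cat_w_lt x y : 0 <= x -> x < y -> cat_w c x < cat_w c y.
Proof.
move=> x0 xy; rewrite ltr_pM2r ?invr_gt0// ltr_sqrt ?cat_qc_gt0// ltrD2r.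
rewrite ltr_pM2r ?invr_gt0// ltrD2r ltr_pM2l ?disc_gt0//.
by apply: ltr_cosh; lra.
Qed.

Lemma catenoid_v_le0 s : 0 <= s -> catenoid_v c s <= 0.
Proof.
move=> s0; rewrite catenoid_vE// mulNr oppr_le0 mulr_ge0 ?(ltW c0)//.
rewrite oriented_integral_ge0E//; apply: Rintegral_ge0 => t _.
exact/ltW/cat_dv_gt0.
Qed.

Lemma catenoid_v_lt x y : x < y -> catenoid_v c y < catenoid_v c x.
Proof.
move=> xy; rewrite !catenoid_vE// !mulNr ltrN2 ltr_pM2l//.
apply: oriented_integral_lt => //; first exact: continuous_cat_dv.
by move=> t; exact: cat_dv_gt0.
Qed.

Lemma cat_z_lt x y : 0 <= x -> x < y -> cat_z x < cat_z y.
Proof.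
move=> x0 xy; rewrite /cat_z -coshN -[cosh (catenoid_v c y)]coshN.
have vx := catenoid_v_le0 x0; have vxy := catenoid_v_lt xy.
apply: (@lt_le_trans _ _ (cat_w c y * cosh (- catenoid_v c x))).
  by rewrite ltr_pM2r ?cosh_gt0// cat_w_lt.
rewrite ler_pM2l; last exact: cat_w_gt0.
by apply: ler_cosh; lra.
Qed.

Lemma cat_z_le x y : 0 <= x -> 0 <= y -> (cat_z x <= cat_z y) = (x <= y).
Proof.
move=> x0 y0; have [xy|yx|->] := ltgtP x y; last by rewrite lexx.
  by rewrite ltW// cat_z_lt.
by apply/negbTE; rewrite -ltNge cat_z_lt.
Qed.

Lemma continuous_cat_z : continuous cat_z.
Proof.
apply: (continuous_has_deriv (d := fun t => _)) => t; rewrite /cat_z.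
apply: has_derivM; first exact: has_deriv_cat_w.
exact: has_deriv_cosh (has_deriv_catenoid_v c0 t).
Qed.

Lemma continuous_cat_r : continuous (cat_r c).
Proof.
by apply: (continuous_has_deriv (d := fun t => _)) => t; exact: has_deriv_cat_r.
Qed.

Lemma cat_w_le_z s : cat_w c s <= cat_z s.
Proof. by rewrite /cat_z ler_peMr ?cosh_ge1// ltW// cat_w_gt0. Qed.

Lemma cat_z_unbounded (M : R) : 0 <= M -> exists2 T, 0 <= T & M <= cat_z T.
Proof.
move=> M0; have d0 := disc_gt0 c0; pose T := 2 * (M * c) ^+ 2 / disc c.
have T0 : 0 <= T by rewrite divr_ge0 ?(ltW d0)// mulr_ge0// sqr_ge0.
(* Chosen so that [disc c * T / 2], a lower bound of [cat_q c T + c ^+ 2], is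
   equal to [(M * c) ^+ 2]. *)
exists T => //; apply: le_trans (cat_w_le_z T).
rewrite ler_pdivlMr// -[leLHS]ger0_norm ?mulr_ge0 ?(ltW c0)// -sqrtr_sqr.
rewrite ler_sqrt ?cat_qc_gt0//; last exact/ltW/cat_qc_gt0.
have e1 := expR_ge1Dx (2 * T); have e2 := expR_gt0 (- (2 * T)).
have chT : T <= cosh (2 * T) by rewrite /cosh; lra.
have -> : (M * c) ^+ 2 = disc c * T / 2 by rewrite /T; field; rewrite gt_eqF.
rewrite /cat_q; have : disc c * T <= disc c * cosh (2 * T) by rewrite ler_pM2l.
have := sqr_ge0 c; lra.
Qed.

Lemma cat_z_surj e : 0 < e -> e < (cat_z 0)^-1 ->
  exists2 S, 0 <= S & cat_z S = e^-1.
Proof.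
move=> e0 e1.
have z0 : 0 < cat_z 0 by apply: lt_le_trans (cat_w_le_z 0); exact: cat_w_gt0.
have z0e : cat_z 0 <= e^-1.
  by rewrite -[leLHS]invrK lef_pV2 ?posrE ?invr_gt0// ltW.
have ei : 0 <= e^-1 by rewrite invr_ge0 ltW.
have [T T0 zT] := cat_z_unbounded ei.
have cz : {within `[0, T], continuous cat_z}.
  exact/continuous_subspaceT/continuous_cat_z.
have [|S SI zS] := @IVT _ cat_z _ _ e^-1 T0 cz.
  move: (cat_z 0) (cat_z T) z0e zT => a b ae eb.
  by rewrite ge_min ae le_max eb orbT.
by exists S => //; move: SI; rewrite in_itv/= => /andP[].
Qed.

(** [cat_z] is even and increases on the nonnegative half-line, so truncation
    amounts to [`|s| <= S]. *)
Lemma truncated_area_catenoid e S : 0 <= S -> cat_z S = e^-1 ->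
  truncated_area catenoid_domain (catenoid_X c) e =
  (4 * pi * oriented_integral 0 S (cat_r c))%:E.
Proof.
move=> S0 zS; rewrite /truncated_area /area.
rewrite [X in integral _ X _](_ : _ =
    `[- S, S]%classic `*` `[0, 2 * pi[%classic).
  transitivity (\int[mu \x mu]_(p in
      `[(- S)%R, S]%classic `*` `[0%R, (2 * pi)%R[%classic) (cat_r c p.1)%:E)%E.
    by apply: eq_integral => -[s t] _; rewrite catenoid_area_density.
  rewrite integral_rectangle_fst.
  - rewrite Rintegral_even//; first by congr EFin; ring.
      exact: continuous_cat_r.
    exact: cat_rN.
  - exact: continuous_cat_r.
  - by move=> x; exact/ltW/cat_r_gt0.
  - by rewrite mulr_ge0// pi_ge0.
have ZS s : (cat_z s <= e^-1) = (s \in `[- S, S]).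
  rewrite -zS in_itv/= -ler_norml; have [s0|s0] := leP 0 s.
    by rewrite ger0_norm// cat_z_le.
  by rewrite ltr0_norm// -cat_zN cat_z_le// oppr_ge0 ltW.
apply/seteqP; split => -[s t] /=.
  move=> [[_ t1]]; have [_ _ _ ->] := catenoid_XE c0 s t.
  by rewrite -/(cat_z s) ZS.
move=> [s1 t1]; have [_ _ _ ->] := catenoid_XE c0 s t.
by rewrite -/(cat_z s) ZS.
Qed.

End truncation.

(** * Reduction of the area integral to elliptic integrals *)

Section parallelism.
Context {R : realType}.
Implicit Types (s z t : R).

(** Lobachevsky's angle of parallelism. The substitution
    [sin t = (cosh s)^-1] it realizes turns integrals over the profile curve
    into elliptic integrals over a quarter period. *)
Definition parallelism s : R := 2 * atan (expR (- s)).

Lemma sin_parallelism s : sin (parallelism s) = (cosh s)^-1.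
Proof.
set y := expR (- s); have y0 : 0 < y := expR_gt0 _.
have e : cosh s = (1 + y ^+ 2) / (2 * y).
  rewrite /cosh -/y -[s in expR s]opprK expRN -/y; field.
  by rewrite gt_eqF.
have y1 : 1 + y ^+ 2 != 0 by rewrite gt_eqF// addr_gt0// exprn_gt0.
have c2 : cos (atan y) ^+ 2 = (1 + y ^+ 2)^-1.
  by rewrite cos_atan exprVn sqr_sqrtr// addr_ge0// sqr_ge0.
have sc : sin (atan y) = y * cos (atan y).
  rewrite -[X in _ = X * _](atanK y) /tan mulfVK// cos_atan.
  rewrite invr_eq0 sqrtr_eq0 -ltNge.
  by rewrite addr_gt0// exprn_gt0.
rewrite /parallelism mulr_natl sin_mulr2n -/y sc mulrCA -expr2 c2 e -mulr_natl.
by field; rewrite y1 gt_eqF.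
Qed.

Lemma cos_parallelism s : cos (parallelism s) = sinh s / cosh s.
Proof.
set y := expR (- s); have y0 : 0 < y := expR_gt0 _.
have ys : expR s = y^-1 by rewrite -expRN opprK.
have y1 : 1 + y ^+ 2 != 0 by rewrite gt_eqF// addr_gt0// exprn_gt0.
have c2 : cos (atan y) ^+ 2 = (1 + y ^+ 2)^-1.
  by rewrite cos_atan exprVn sqr_sqrtr// addr_ge0// sqr_ge0.
rewrite /parallelism mulr_natl cos_mulr2n -/y c2 /sinh /cosh -/y ys -mulr_natl.
by field; rewrite y1 gt_eqF.
Qed.

Lemma parallelism0 : parallelism 0 = pi / 2 :> R.
Proof. by rewrite /parallelism oppr0 expR0 atan1; field. Qed.

Lemma has_deriv_parallelism s : has_deriv parallelism s (- (cosh s)^-1).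
Proof.
rewrite /parallelism; derive.
set y := expR (- s); have y0 : 0 < y := expR_gt0 _.
have ys : expR s = y^-1 by rewrite -expRN opprK.
have y1 : 1 + y ^+ 2 != 0 by rewrite gt_eqF// addr_gt0// exprn_gt0.
by rewrite /cosh -/y ys; field; rewrite y1 gt_eqF.
Qed.

Lemma parallelism_gt0 s : 0 < parallelism s.
Proof. by rewrite mulr_gt0// -atan0 lt_atan// expR_gt0. Qed.

Lemma parallelism_le s : parallelism s <= 2 * expR (- s).
Proof.
rewrite ler_pM2l//; set y := expR (- s); have y0 : 0 < y := expR_gt0 _.
have : (fun x => x - atan x) 0 < (fun x => x - atan x) y.
  apply: (@has_deriv_gt0_lt _ (fun x => x - atan x) 0 y
    (fun x => 1 - (1 + x ^+ 2)^-1)) => // x xI; first by derive; ring.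
  have x0 : 0 < x by lra.
  by rewrite subr_gt0 invf_lt1 ?ltrDl ?addr_gt0 ?exprn_gt0.
by rewrite /= atan0 subrr subr_gt0 => /ltW.
Qed.

(** Up to the constant factor [scale] below, the radius [cat_r] in terms of
    the modulus [z]. *)
Definition profile_radius z s : R := Num.sqrt (cosh s ^+ 2 - z ^+ 2).

Lemma profile_radius_gt0 z s : z ^+ 2 < 1 -> 0 < profile_radius z s.
Proof.
move=> z1; rewrite sqrtr_gt0 subr_gt0 (lt_le_trans z1)//.
by rewrite expr_ge1 ?cosh_ge1// ltW// cosh_gt0.
Qed.

Lemma sqr_profile_radius z s : z ^+ 2 < 1 ->
  profile_radius z s ^+ 2 = cosh s ^+ 2 - z ^+ 2.
Proof.
move=> z1; have := profile_radius_gt0 s z1.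
by rewrite sqrtr_gt0 => /ltW/sqr_sqrtr.
Qed.

Lemma has_deriv_profile_radius z s : z ^+ 2 < 1 ->
  has_deriv (profile_radius z) s (cosh s * sinh s / profile_radius z s).
Proof.
move=> z1; have := profile_radius_gt0 s z1; rewrite /profile_radius => T0.
derive; first by rewrite -sqrtr_gt0.
by field; rewrite gt_eqF.
Qed.

Lemma g_integrand_parallelism z s : z ^+ 2 < 1 ->
  g_integrand z (parallelism s) =
  z ^+ 2 * sinh s ^+ 2 / (cosh s * profile_radius z s).
Proof.
move=> z1; have T0 := profile_radius_gt0 s z1; have C0 := cosh_gt0 s.
have T2 := sqr_profile_radius s z1.
rewrite /g_integrand cos_parallelism /Delta sin_parallelism.
move: (profile_radius z s) (cosh s) (sinh s) T0 C0 T2 => T C S T0 C0 T2.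
have -> : Num.sqrt (1 - z ^+ 2 * C^-1 ^+ 2) = T / C.
  rewrite -[RHS]ger0_norm ?divr_ge0 ?ltW// -sqrtr_sqr expr_div_n T2.
  by congr Num.sqrt; field; rewrite gt_eqF.
by field; rewrite !gt_eqF.
Qed.

(** The boundary term carries the exponential growth. Its derivative exceeds
    the integrand by [z ^+ 2 * sinh s ^+ 2 / (cosh s ^+ 2 * profile_radius z s)],
    whose integral over the half-line is [ellipticG z] after the substitution
    [parallelism]; the last term is the tail of that integral. *)
Lemma profile_integral z s : z ^+ 2 < 1 ->
  oriented_integral 0 s (profile_radius z) =
  sinh s / cosh s * profile_radius z s - ellipticG z
  + oriented_integral 0 (parallelism s) (g_integrand z).
Proof.
move=> z1; have cg := continuous_g_integrand z1.
have cT : continuous (profile_radius z).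
  by apply: continuous_has_deriv => t; exact: has_deriv_profile_radius.
pose F t := sinh t / cosh t * profile_radius z t
  + oriented_integral 0 (parallelism t) (g_integrand z).
have F' t : has_deriv F t (profile_radius z t).
  have T0 := profile_radius_gt0 t z1; have C0 := cosh_gt0 t.
  rewrite /F; apply: has_deriv_eq.
    apply: has_derivD.
      apply: has_derivM; last exact: has_deriv_profile_radius.
      apply: has_derivM; first by derive_rules.
      apply: has_derivV; first by rewrite gt_eqF.
      by derive_rules.
    apply: (has_deriv_comp
      (f := fun t => oriented_integral 0 t (g_integrand z))).
      exact: has_deriv_oriented_integral.
    exact: has_deriv_parallelism.
  cbv beta; rewrite g_integrand_parallelism//.
  have := sqr_profile_radius t z1; have := cosh_sq t.
  move: (profile_radius z t) (cosh t) (sinh t) T0 C0 => T C S T0 C0 CS T2.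
  have T1 : T != 0 by rewrite gt_eqF.
  have C1 : C != 0 by rewrite gt_eqF.
  have zE : z ^+ 2 = C ^+ 2 - T ^+ 2 by rewrite T2; ring.
  by rewrite zE; field: CS; rewrite T1 C1.
rewrite (oriented_integralFTC s cT F') /F sinh0 mul0r mul0r add0r parallelism0.
rewrite [X in _ - X]oriented_integral_ge0E ?divr_ge0 ?pi_ge0// ellipticG_trig//.
by ring.
Qed.

End parallelism.

Section catenoid_modulus.
Context {R : realType} (c : R) (c0 : 0 < c).
Implicit Types s : R.

Lemma sqr_zeta : zeta c ^+ 2 = (c ^+ 2 + disc c) / (2 * disc c).
Proof.
rewrite /zeta -/(disc c) sqr_sqrtr// divr_ge0 ?addr_ge0 ?sqr_ge0//.
  exact/ltW/disc_gt0.
by rewrite mulr_ge0//; exact/ltW/disc_gt0.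
Qed.

Lemma zeta_ge0 : 0 <= zeta c. Proof. exact: sqrtr_ge0. Qed.

Lemma sqr_zeta_lt1 : zeta c ^+ 2 < 1.
Proof.
have d0 := disc_gt0 c0; have d1 := disc_gt c0.
by rewrite sqr_zeta ltr_pdivrMr ?mulr_gt0//; lra.
Qed.

Lemma zeta2B1 : 2 * zeta c ^+ 2 - 1 = c ^+ 2 / disc c.
Proof. by rewrite sqr_zeta; field; rewrite gt_eqF// disc_gt0. Qed.

Lemma zeta_bounds : Num.sqrt 2 / 2 < zeta c < 1.
Proof.
have d0 := disc_gt0 c0; have z1 := sqr_zeta_lt1; have z0 := zeta_ge0.
apply/andP; split; last by rewrite -ltr_sqr ?nnegrE// expr1n.
rewrite -ltr_sqr ?nnegrE ?divr_ge0 ?sqrtr_ge0// expr_div_n sqr_sqrtr//.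
have : 0 < 2 * zeta c ^+ 2 - 1 by rewrite zeta2B1 divr_gt0// exprn_gt0.
lra.
Qed.

(** The factor [1 / sqrt (2 * zeta ^ 2 - 1)] of the closed form. *)
Definition scale : R := Num.sqrt (disc c) / c.

Lemma scale_gt0 : 0 < scale.
Proof. by rewrite divr_gt0// sqrtr_gt0 disc_gt0. Qed.

Lemma scaleE : scale = (Num.sqrt (2 * zeta c ^+ 2 - 1))^-1.
Proof.
rewrite zeta2B1 sqrtrM ?sqr_ge0// sqrtr_sqr gtr0_norm// sqrtrV; last first.
  exact/ltW/disc_gt0.
by rewrite invf_div.
Qed.

Lemma cat_rE s : cat_r c s = scale * profile_radius (zeta c) s.
Proof.
have d0 := disc_gt0 c0.
rewrite /cat_r /scale /profile_radius mulrAC -sqrtrM ?ltW//.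
congr (Num.sqrt _ / _); rewrite /cat_q cosh_double sqr_zeta.
by field; rewrite gt_eqF.
Qed.

Lemma cat_wE s : cat_w c s = scale * Num.sqrt (sinh s ^+ 2 + zeta c ^+ 2).
Proof.
have d0 := disc_gt0 c0; rewrite /cat_w /scale mulrAC -sqrtrM ?ltW//.
congr (Num.sqrt _ / _); rewrite /cat_q cosh_double cosh_sq sqr_zeta.
by field; rewrite gt_eqF.
Qed.

Lemma catenoid_half_area S : oriented_integral 0 S (cat_r c) =
  scale * (sinh S / cosh S * profile_radius (zeta c) S - ellipticG (zeta c)
    + oriented_integral 0 (parallelism S) (g_integrand (zeta c))).
Proof.
have z1 := sqr_zeta_lt1; rewrite -profile_integral//.
have cT : continuous (profile_radius (zeta c)).
  by apply: continuous_has_deriv => t; exact: has_deriv_profile_radius.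
rewrite (oriented_integralFTC (F := fun t => scale *
    oriented_integral 0 t (profile_radius (zeta c)))).
- by rewrite [oriented_integral 0 0 _]subrr mulr0 subr0.
- exact: continuous_cat_r.
- move=> t; rewrite cat_rE; apply: has_deriv_eq.
    apply: has_derivM; first exact: has_deriv_cst.
    exact: has_deriv_oriented_integral.
  by rewrite mulr0 addr0.
Qed.

End catenoid_modulus.

(** * Expansion of the truncated area *)

(** [Y] and [y] stand for [expR S] and [expR (- S)], [w * V] for the height of
    the truncation, with [V] close to its limit [H], and [A] for the boundary
    term of the area. Both [A] and [w] are asymptotic to a multiple of [Y] with
    error of order [y], and so is [e^-1]; hence the error is of order [y], that
    is, of order [e]. *)
Lemma expansion_arith {R : realType} (m H E B Y y P w V A Ci G e : R) :
  0 < m -> 0 < H -> 0 < E -> 0 <= B -> 0 < Y -> 0 < y -> y <= 1 -> Y * y = 1 ->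
  0 <= P -> P <= 2 * y -> 0 < w ->
    m * ((Y - y) / 2) <= w -> w <= m * ((Y + y) / 2) ->
  H - E * B / 2 * y ^+ 2 <= V -> V <= H ->
  A <= (Y - y) / 2 -> (Y - y) / 2 - Ci <= A -> Ci <= 2 * y ->
  0 < e -> w * V = e^-1 ->
  `|4 * pi * (m * (A - G + P)) - (4 * pi / H * e^-1 - 4 * pi * m * G)|
  <= 4 * pi * (5 * m + (m / 2 + m * E * B / (2 * H))) * (m * H) * e.
Proof.
move=> m0 H0 E0 B0 Y0 y0 y1 yY P0 P2 w0 wl wu Vl Vu Al Au Cy e0 wV.
have p0 := @pi_gt0 R.
set K := m / 2 + m * E * B / (2 * H).
have yY' : y <= Y by have : 1 <= Y by [nra|]; lra.
have wY : w <= m * Y by apply: le_trans wu _; rewrite ler_pM2l//; lra.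
have Zu : e^-1 / H <= m * Y / 2 + m * y / 2.
  rewrite -wV ler_pdivrMr//; apply: (@le_trans _ _ (w * H)); first
    by rewrite ler_pM2l.
  by rewrite ler_pM2r//; lra.
have Zl : m * Y / 2 - K * y <= e^-1 / H.
  rewrite -wV ler_pdivlMr//.
  have h1 : w * (H - E * B / 2 * y ^+ 2) <= w * V by rewrite ler_pM2l.
  apply: le_trans h1.
  have EB : 0 <= E * B / 2 * y ^+ 2
    by apply: mulr_ge0 (sqr_ge0 _); rewrite divr_ge0// mulr_ge0// ltW.
  have h2 : w * (E * B / 2 * y ^+ 2) <= m * Y * (E * B / 2 * y ^+ 2)
    by rewrite ler_wpM2r.
  have h3 : m * ((Y - y) / 2) * H <= w * H by rewrite ler_pM2r.
  have h4 : m * Y * (E * B / 2 * y ^+ 2) = m * E * B / 2 * y.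
    by rewrite -[y in RHS]mul1r -yY; ring.
  have -> : (m * Y / 2 - K * y) * H = m * ((Y - y) / 2) * H - m * E * B / 2 * y.
    by rewrite /K; field; rewrite gt_eqF.
  lra.
have ye : y <= m * H * e.
  have h : e^-1 <= m * Y * H.
    rewrite -wV; apply: (@le_trans _ _ (w * H)); first by rewrite ler_pM2l.
    by rewrite ler_pM2r.
  have ye0 : 0 <= y * e by rewrite mulr_ge0// ltW.
  have := ler_wpM2l ye0 h; rewrite mulfK ?gt_eqF//.
  have -> // : y * e * (m * Y * H) = m * H * e.
  by rewrite -[RHS]mul1r -yY; ring.
have K0 : 0 <= K.
  by rewrite addr_ge0 ?divr_ge0 ?mulr_ge0 ?(ltW m0) ?(ltW E0) ?(ltW H0).
have mA1 : m * A <= m * ((Y - y) / 2) by rewrite ler_pM2l.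
have mA2 : m * ((Y - y) / 2 - 2 * y) <= m * A by rewrite ler_pM2l//; lra.
have mP1 : m * P <= m * (2 * y) by rewrite ler_pM2l.
have mP0 : 0 <= m * P by rewrite mulr_ge0// ltW.
have my0 : 0 <= m * y by rewrite mulr_ge0// ltW.
have Ky0 : 0 <= K * y by rewrite mulr_ge0// ltW.
have D : `|m * A + m * P - e^-1 / H| <= (5 * m + K) * y
  by rewrite ler_norml; lra.
have -> : 4 * pi * (m * (A - G + P)) - (4 * pi / H * e^-1 - 4 * pi * m * G) =
  4 * pi * (m * A + m * P - e^-1 / H) by ring.
rewrite normrM ger0_norm ?mulr_ge0 ?(ltW p0)//
  -!(mulrA (4 * pi)) ler_pM2l ?mulr_gt0//.
apply: (le_trans D); rewrite -!mulrA ler_wpM2l// ?[leRHS]mulrA//.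
by rewrite addr_ge0// mulr_ge0// ltW.
Qed.

Section expansion.
Context {R : realType} (c : R) (c0 : 0 < c).
Notation mu := (@lebesgue_measure R).
Implicit Types s S T : R.

Lemma parallelism_integral_bounds z S : z ^+ 2 < 1 -> 0 <= S ->
  0 <= oriented_integral 0 (parallelism S) (g_integrand z) <= 2 * expR (- S).
Proof.
move=> z1 S0; have t0 := parallelism_gt0 S; have cg := continuous_g_integrand z1.
have tpi : parallelism S <= pi / 2.
  have -> : pi / 2 = 2 * atan 1 :> R by rewrite atan1; field.
  by rewrite ler_pM2l// le_atan// -[leRHS]expR0 ler_expR oppr_le0.
rewrite oriented_integral_ge0E ?(ltW t0)//; apply/andP; split.
  apply: Rintegral_ge0 => t _; apply: divr_ge0; last exact/ltW/Delta_gt0.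
  by rewrite mulr_ge0// sqr_ge0.
apply: le_trans (parallelism_le S).
apply: (@le_trans _ _ (\int[mu]_(t in `[0, parallelism S]) 1)).
  apply: le_Rintegral => //; try exact: continuous_integrable.
    exact/continuous_integrable/cst_continuous.
  move=> t; rewrite /= in_itv/= => /andP[ta tb].
  have c1 : 0 <= cos t by apply: cos_ge0_pihalf; lra.
  have cD := cos_le_Delta t z1; have D0 := Delta_gt0 t z1.
  rewrite /g_integrand ler_pdivrMr// mul1r.
  apply: le_trans cD; rewrite expr2 mulrA ler_piMl//.
  by rewrite mulr_ile1 ?sqr_ge0 ?(ltW z1)// cos_le1.
rewrite -oriented_integral_ge0E ?(ltW t0)//.
rewrite (oriented_integralFTC (F := fun t => t)) ?subr0//.
  exact: cst_continuous.
by move=> t; exact: has_deriv_id.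
Qed.

(** The rapidity of the translation along the axis converges. The rate
    [expR (- 2 * S)] is what matters: multiplied by the growth [expR S] of the
    radius, the error is still of the order of [e]. *)
Lemma catenoid_v_limit : exists L B : R, 0 <= B /\ forall S, 0 <= S ->
  0 <= - catenoid_v c S <= L /\ L <= - catenoid_v c S + B * expR (- (2 * S)).
Proof.
have a0 := disc_gt0 c0.
pose q0 := (disc c - c ^+ 2) / 2.
have q00 : 0 < q0 by rewrite divr_gt0// subr_gt0 disc_gt.
pose k := 4 / (disc c * Num.sqrt q0).
have k0 : 0 < k by rewrite divr_gt0// mulr_gt0// sqrtr_gt0.
have dv s : cat_dv c s <= k * expR (- (2 * s)).
  have q1 : q0 <= cat_q c s.
    rewrite /q0 /cat_q ler_pM2r ?invr_gt0// lerD2r ler_peMr ?cosh_ge1// ltW//.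
  have q2 : disc c * expR (2 * s) / 4 <= cat_q c s + c ^+ 2.
    have ch : expR (2 * s) / 2 <= cosh (2 * s).
      by rewrite /cosh ler_pM2r ?invr_gt0// lerDl ltW// expR_gt0.
    rewrite /cat_q; have := sqr_ge0 c.
    have : disc c * (expR (2 * s) / 2) <= disc c * cosh (2 * s)
      by rewrite ler_pM2l.
    lra.
  have -> : k * expR (- (2 * s)) =
      (Num.sqrt q0 * (disc c * expR (2 * s) / 4))^-1.
    have sq0 : Num.sqrt q0 != 0 by rewrite gt_eqF// sqrtr_gt0.
    have d0 : disc c != 0 by rewrite gt_eqF.
    have x0 : expR (2 * s) != 0 by rewrite gt_eqF// expR_gt0.
    by rewrite /k expRN; field; rewrite sq0 d0 x0.
  have sq0 : 0 < Num.sqrt q0 by rewrite sqrtr_gt0.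
  have sqs : 0 < Num.sqrt (cat_q c s) by rewrite sqrtr_gt0 cat_q_gt0.
  have de : 0 < disc c * expR (2 * s) / 4.
    by rewrite divr_gt0// mulr_gt0// expR_gt0.
  have qc := cat_qc_gt0 c0 s.
  rewrite /cat_dv lef_pV2 ?posrE; [|exact: mulr_gt0|exact: mulr_gt0].
  apply: ler_pM; [exact: ltW|exact: ltW| |exact: q2].
  by rewrite ler_sqrt//; exact/ltW/cat_q_gt0.
pose B := c * k; have B0 : 0 <= B by rewrite mulr_ge0// ltW.
have N0 S : 0 <= S -> 0 <= - catenoid_v c S by move=> /(catenoid_v_le0 c0); lra.
have Nle S T : S <= T -> - catenoid_v c S <= - catenoid_v c T.
  rewrite le_eqVlt => /predU1P[->//|ST].
  by rewrite lerN2 ltW// catenoid_v_lt.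
have NB S T : S <= T ->
    - catenoid_v c T <= - catenoid_v c S + B * expR (- (2 * S)).
  rewrite le_eqVlt => /predU1P[->|ST]; first
    by rewrite lerDl mulr_ge0// expR_ge0.
  have := @has_deriv_gt0_lt _ (fun s => catenoid_v c s - B * expR (- (2 * s)))
    S T (fun s => - c * cat_dv c s + 2 * B * expR (- (2 * s))) ST.
  move=> H; have /H{H}H : forall x, S <= x <= T ->
      has_deriv (fun s => catenoid_v c s - B * expR (- (2 * s))) x
        (- c * cat_dv c x + 2 * B * expR (- (2 * x))).
    move=> x _; apply: has_deriv_eq.
      by apply: has_derivD; [exact: has_deriv_catenoid_v|derive_rules].
    by cbv beta; ring.
  have /H{H} : forall x, S < x < T ->
    0 < - c * cat_dv c x + 2 * B * expR (- (2 * x)).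
    move=> x _; have := dv x; rewrite -(ler_pM2l c0) /B.
    have : 0 < c * (k * expR (- (2 * x)))
      by rewrite mulr_gt0// mulr_gt0// expR_gt0.
    lra.
  have : 0 <= B * expR (- (2 * T)) by rewrite mulr_ge0// expR_ge0.
  lra.
pose E := [set - catenoid_v c s | s in [set s | 0 <= s]].
have E0 : E !=set0 by exists (- catenoid_v c 0); exists 0 => //=.
have Eub S : 0 <= S -> ubound E (- catenoid_v c S + B * expR (- (2 * S))).
  move=> S0 _ [T /= T0 <-]; have [TS|ST] := leP T S; last exact/NB/ltW.
  by rewrite (le_trans (Nle _ _ TS))// lerDl mulr_ge0// expR_ge0.
exists (sup E), B; split => // S S0; split;
  last by apply: ge_sup => //; exact: Eub.
rewrite N0//=; apply: ub_le_sup; last by exists S.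
by exists (- catenoid_v c 0 + B * expR (- (2 * 0))); exact: Eub.
Qed.

(** The height and the area grow at the same exponential rate, so eliminating
    [S] leaves a single polar term in [e], and the constant term of the area
    is the one of [catenoid_half_area]. *)
Lemma area_expansion : exists a0 C : R, forall S e, 0 <= S -> 0 < e ->
  cat_z c S = e^-1 ->
  `|4 * pi * oriented_integral 0 S (cat_r c)
    - (a0 * e^-1 - 4 * pi * scale c * ellipticG (zeta c))| <= C * e.
Proof.
have [L [B [B0 LB]]] := catenoid_v_limit.
have z1 := sqr_zeta_lt1 c0; have m0 := scale_gt0 c0.
pose H := cosh L; have H0 : 0 < H by exact: cosh_gt0.
have EL := expR_gt0 L.
pose K1 := scale c / 2 + scale c * expR L * B / (2 * H).
exists (4 * pi / H), (4 * pi * (5 * scale c + K1) * (scale c * H)).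
move=> S e S0 e0 zS.
rewrite catenoid_half_area//.
have [/andP[N0 NL] LN] := LB _ S0.
have y0 : 0 < expR (- S) := expR_gt0 _.
have y1 : expR (- S) <= 1 by rewrite -[leRHS]expR0 ler_expR oppr_le0.
have Y0 : 0 < expR S := expR_gt0 _.
have yY := expR_mulN S.
have y2 : expR (- (2 * S)) = expR (- S) ^+ 2.
  by rewrite -expRM_natl -mulr_natl mulrN.
have /andP[P0 P2] := parallelism_integral_bounds z1 S0.
have C0 := cosh_gt0 S; have C1 := cosh_ge1 S; have CS := cosh_sq S.
have T0 := profile_radius_gt0 S z1; have T2 := sqr_profile_radius S z1.
have sS : sinh S = (expR S - expR (- S)) / 2 by [].
have cS : cosh S = (expR S + expR (- S)) / 2 by [].
have S'0 : 0 <= sinh S.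
  by rewrite sS divr_ge0// subr_ge0 ler_expR; lra.
have w_le : scale c * sinh S <= cat_w c S <= scale c * cosh S.
  rewrite cat_wE// !ler_pM2l// -[X in X <= _ <= _]ger0_norm// -sqrtr_sqr.
  rewrite -[X in _ <= _ <= X]gtr0_norm// -sqrtr_sqr !ler_sqrt ?sqr_ge0//.
  - by rewrite lerDl sqr_ge0 CS addrC lerD2r ltW.
  - by rewrite addr_ge0 ?sqr_ge0.
have chv : H - expR L * B / 2 * expR (- S) ^+ 2 <= cosh (catenoid_v c S) <= H.
  rewrite -coshN; apply/andP; split; last exact: ler_cosh.
  move: N0 NL LN; rewrite y2; move: (- catenoid_v c S) => N N0 NL LN.
  have eNL : expR L * (1 + (N - L)) <= expR N.
    rewrite -[N in leRHS](subrKC L) expRD ler_pM2l//.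
    exact: expR_ge1Dx.
  have eLN : expR (- L) <= expR (- N) by rewrite ler_expR lerN2.
  have : expR L * (L - N) <= expR L * (B * expR (- S) ^+ 2)
    by rewrite ler_pM2l//; lra.
  rewrite /H /cosh; lra.
have Tle : profile_radius (zeta c) S <= cosh S.
  rewrite -ler_sqr ?nnegrE ?(ltW T0) ?(ltW C0)// T2.
  by rewrite lerBlDr lerDl sqr_ge0.
have Tge : cosh S - (cosh S)^-1 <= profile_radius (zeta c) S.
  have Ci : (cosh S)^-1 <= cosh S.
    by rewrite (le_trans _ C1)// invf_le1.
  rewrite -ler_sqr ?nnegrE ?subr_ge0 ?(ltW T0)// T2.
  have : cosh S * (cosh S)^-1 = 1 by rewrite mulfV// gt_eqF.
  have : (cosh S)^-1 ^+ 2 <= 1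
    by rewrite expr_le1 ?invr_ge0 ?(ltW C0)// invf_le1.
  rewrite sqrrB => ? ->; lra.
have Cy : (cosh S)^-1 <= 2 * expR (- S).
  rewrite -div1r ler_pdivrMr// cS; have := sqr_ge0 (expR (- S)); lra.
have SC : sinh S <= cosh S by lra.
have A_le : sinh S / cosh S * profile_radius (zeta c) S <= sinh S.
  by rewrite mulrAC ler_pdivrMr// ler_wpM2l.
have A_ge : sinh S - (cosh S)^-1 <= sinh S / cosh S * profile_radius (zeta c) S.
  have : sinh S / cosh S * (cosh S - (cosh S)^-1) <=
         sinh S / cosh S * profile_radius (zeta c) S.
    by rewrite ler_wpM2l// divr_ge0// ltW.
  apply: le_trans; rewrite mulrBr mulfVK ?gt_eqF// lerD2l lerN2.
  by rewrite ler_piMl ?invr_ge0 ?(ltW C0)// ler_pdivrMr// mul1r.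
have w0 := cat_w_gt0 c0 S.
move: zS; rewrite /cat_z; move/andP: w_le => [w_ge w_le].
move: chv A_le A_ge Cy; rewrite sS; rewrite sS in w_ge; rewrite cS in w_le.
move: (cat_w c S) (cosh (catenoid_v c S)) w0 w_ge w_le => w V w0 w_ge w_le.
move: (cosh S)^-1 (_ / _ * profile_radius _ _) => Ci A.
move: (oriented_integral _ _ _) (ellipticG _) P0 P2 => P G P0 P2.
move=> /andP[Vl Vu] A_le A_ge Cy wV.
exact: (expansion_arith G m0 H0 EL B0 Y0 y0 y1 yY P0 P2 w0 w_ge w_le Vl Vu
  A_le A_ge Cy e0 wV).
Qed.
End expansion.

(** * The renormalized area *)

Section constant_term.
Context {R : realType}.

Lemma eq0_of_le_linear (x K : R) :
  (\forall e \near (0 : R)^'+, `|x| <= K * e) -> x = 0.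
Proof.
move=> xK; apply/eqP; apply: contraT => x0.
have K0 : 0 < `|K| + 1 by rewrite ltr_wpDl.
near (0 : R)^'+ => e; have e0 : 0 < e by [].
have ex : e < `|x| / (`|K| + 1).
  by near: e; apply: nbhs_right_lt; rewrite divr_gt0 ?normr_gt0.
have : `|x| <= K * e by near: e.
rewrite ltr_pdivlMr// in ex; rewrite leNgt (le_lt_trans _ ex)//.
by rewrite mulrC ler_pM2l// (le_trans (ler_norm _))// lerDl.
Unshelve. all: by end_near. Qed.

(** Multiplying by the matching power of [e] isolates the most singular
    coefficient, which must vanish; so do the others, one after the other. *)
Lemma polar_part_constant (n : nat) (b : nat -> R) (B C : R) :
  (\forall e \near (0 : R)^'+, `|\sum_(k < n) b k * e ^- k.+1 + B| <= C * e) ->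
  B = 0.
Proof.
elim: n => [|n IHn] in b *.
  move=> h; apply: (@eq0_of_le_linear _ C); apply: filterS h => e.
  by rewrite big_ord0 add0r.
move=> h; have bn0 : b n = 0.
  apply: (@eq0_of_le_linear _ (`|C| + \sum_(k < n) `|b k| + `|B|)).
  near=> e.
  have e0 : 0 < e by [].
  have e1 : e <= 1 by near: e; apply: nbhs_right_le.
  have en k : (0 < k)%N -> e ^+ k <= e.
    by case: k => // k _; rewrite exprS ler_piMr ?exprn_ile1// ltW.
  have : `|\sum_(k < n.+1) b k * e ^- k.+1 + B| <= C * e by near: e.
  have enz k : e ^+ k != 0 by rewrite expf_neq0// gt_eqF.
  rewrite big_ord_recr /=; set S := \sum_(_ < _) _ => XC.
  have SE : `|S * e ^+ n.+1| <= (\sum_(k < n) `|b k|) * e.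
    rewrite /S !mulr_suml; apply: le_trans (ler_norm_sum _ _ _) _.
    apply: ler_sum => k _; have kn := ltn_ord k.
    rewrite -mulrA normrM ler_wpM2l//.
    have -> : e ^+ n.+1 = e ^+ k.+1 * e ^+ (n - k).
      by rewrite -exprD addSn subnKC// ltnW.
    by rewrite mulKf// ger0_norm ?exprn_ge0 ?(ltW e0)// en// subn_gt0.
  have bE : b n = (S + b n * e ^- n.+1 + B) * e ^+ n.+1 - S * e ^+ n.+1
      - B * e ^+ n.+1.
    by rewrite !mulrDl mulfVK//; ring.
  rewrite {}bE [leRHS]mulrDl [X in _ <= X + _]mulrDl.
  have E1 : `|(S + b n * e ^- n.+1 + B) * e ^+ n.+1| <= `|C| * e.
    rewrite normrM [X in _ * X]ger0_norm ?exprn_ge0 ?(ltW e0)//.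
    apply: (@le_trans _ _ (`|S + b n * e ^- n.+1 + B| * 1)).
      by rewrite ler_wpM2l// exprn_ile1// ltW.
    rewrite mulr1; apply: le_trans XC _.
    by rewrite ler_pM2r// ler_norm.
  have E2 : `|B * e ^+ n.+1| <= `|B| * e.
    rewrite normrM ler_wpM2l// ger0_norm ?exprn_ge0 ?(ltW e0)//; exact: en.
  apply: le_trans (ler_normB _ _) _; apply: lerD => //.
  by apply: le_trans (ler_normB _ _) _; exact: lerD.
apply: (IHn b); apply: filterS h => e.
by rewrite big_ord_recr /= bn0 mul0r addr0.
Unshelve. all: by end_near. Qed.

Lemma is_renormalized_area_unique D (X : R * R -> 'rV[R]_4) (A A' : R) :
  is_renormalized_area D X A -> is_renormalized_area D X A' -> A = A'.
Proof.
move=> [n [a [C h]]] [n' [a' [C' h']]]; apply/eqP; rewrite -subr_eq0; apply/eqP.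
pose b k := (if (k < n)%N then a k else 0) - (if (k < n')%N then a' k else 0).
apply: (@polar_part_constant (n + n') b _ (C + C')).
have pad m (g : nat -> R) e : (m <= n + n')%N ->
    \sum_(k < m) g k * e ^- k.+1 =
    \sum_(k < n + n') (if (k < m)%N then g k else 0) * e ^- k.+1.
  move=> mn; rewrite (big_ord_widen _ (fun k => g k * e ^- k.+1) mn) big_mkcond.
  by apply: eq_bigr => k _; case: ifP => //; rewrite mul0r.
near=> e.
have : (`|truncated_area D X e - (\sum_(k < n) a k * e ^- k.+1 + A)%:E|
    <= (C * e)%:E)%E.
  by near: e.
have : (`|truncated_area D X e - (\sum_(k < n') a' k * e ^- k.+1 + A')%:E|
    <= (C' * e)%:E)%E.
  by near: e.
rewrite !(pad n) ?(pad n') ?leq_addr ?leq_addl//.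
case: (truncated_area D X e) => [r| |]//=.
rewrite !lee_fin => h1 h2.
have -> : \sum_(k < n + n') b k * e ^- k.+1 =
    \sum_(k < n + n') (if (k < n)%N then a k else 0) * e ^- k.+1 -
    \sum_(k < n + n') (if (k < n')%N then a' k else 0) * e ^- k.+1.
  by rewrite -sumrB; apply: eq_bigr => k _; rewrite -mulrBl.
move: h1 h2; rewrite !ler_norml; lra.
Unshelve. all: by end_near. Qed.

End constant_term.

Section renormalized.
Context {R : realType}.
Implicit Types c : R.

Lemma catenoid_renormalized c : 0 < c ->
  is_catenoid_AR c (- (4 * pi) * scale c * ellipticG (zeta c)).
Proof.
move=> c0; have [a0 [C aC]] := area_expansion c0.
exists 1%N, (fun=> a0), C.
have z0 : 0 < cat_z c 0.
  by apply: lt_le_trans (cat_w_le_z c0 0); exact: cat_w_gt0.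
near=> e.
have e0 : 0 < e by [].
have e1 : e < (cat_z c 0)^-1.
  by near: e; apply: nbhs_right_lt; rewrite invr_gt0.
have [S S0 zS] := cat_z_surj c0 e0 e1.
rewrite (truncated_area_catenoid c0 S0 zS) -EFinB lee_fin big_ord1 expr1.
have := aC S e S0 e0 zS; congr (`|_ - _| <= _); ring.
Unshelve. all: by end_near. Qed.

Lemma catenoid_ARP c : 0 < c ->
  is_catenoid_AR c (catenoid_AR c) /\
  catenoid_AR c = - (4 * pi) * scale c * ellipticG (zeta c).
Proof.
move=> c0; have h := catenoid_renormalized c0.
suff e : catenoid_AR c = - (4 * pi) * scale c * ellipticG (zeta c) by rewrite e.
by apply: xget_unique => // y hy; exact: is_renormalized_area_unique hy h.
Qed.
End renormalized.

(** * Dependence on the parameter *)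

Lemma cvgy_lt_decreasing {R : realType} (f : R -> R) (a l : R) :
  (forall x y, a <= x -> x < y -> f y < f x) -> f x @[x --> +oo] --> l -> l < f a.
Proof.
move=> fdec fl; have a1 : a < a + 1 by rewrite ltrDl.
have h1 := fdec _ _ (lexx a) a1; apply: le_lt_trans h1.
rewrite leNgt; apply/negP => h; have e0 : 0 < l - f (a + 1) by lra.
have /cvgrPdist_lt/(_ _ e0) fe := fl.
near (pinfty_nbhs R) => y.
have ay : a + 1 < y by near: y; apply: nbhs_pinfty_gt; exact: num_real.
have h2 := fdec _ _ (ltW a1) ay.
have : `|l - f y| < l - f (a + 1) by near: y; exact: fe.
by rewrite ltr_norml; lra.
Unshelve. all: by end_near. Qed.

Section parameter.
Context {R : realType}.
Implicit Types c d z : R.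

Lemma has_deriv_zeta c : 0 < c ->
  has_deriv (@zeta R) c (2 * c / (disc c ^+ 3 * zeta c)).
Proof.
move=> c0; have d0 := disc_gt0 c0; have /andP[z0 _] := zeta_bounds c0.
have z1 : 0 < zeta c by apply: le_lt_trans z0; rewrite divr_ge0 ?sqrtr_ge0.
have d2 := sqr_disc c0; have c4 : 0 < c ^+ 4 + 4 by rewrite -d2 exprn_gt0.
rewrite /zeta; derive => //.
- by rewrite -sqrtr_gt0; exact: z1.
- by rewrite -/(disc c) mulf_neq0// gt_eqF.
rewrite -/(zeta c) -/(disc c).
have dn : disc c != 0 by rewrite gt_eqF.
have zn : zeta c != 0 by rewrite gt_eqF.
have c4E : c ^+ 4 = disc c ^+ 2 - 4 by rewrite d2; ring.
move: (zeta c) (disc c) dn zn c4E => Z D Dn Zn c4E.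
by field: c4E; rewrite Dn Zn.
Qed.

Lemma zeta_lt c d : 0 < c -> c < d -> zeta c < zeta d.
Proof.
move=> c0 cd; apply: (@has_deriv_gt0_lt _ (@zeta R) c d
  (fun x => 2 * x / (disc x ^+ 3 * zeta x))) => // x xI.
  by apply: has_deriv_zeta; lra.
have x0 : 0 < x by lra.
have /andP[z0 _] := zeta_bounds x0.
have z1 : 0 < zeta x by apply: le_lt_trans z0; rewrite divr_ge0 ?sqrtr_ge0.
by rewrite divr_gt0 ?mulr_gt0 ?exprn_gt0 ?disc_gt0.
Qed.

Lemma zeta_surj z : Num.sqrt 2 / 2 < z < 1 -> exists2 c, 0 < c & zeta c = z.
Proof.
move=> /andP[zl zr]; have s2 : 0 < Num.sqrt 2 :> R by rewrite sqrtr_gt0.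
have z0 : 0 < z by lra.
have z2 : 1 / 2 < z ^+ 2.
  rewrite (_ : 1 / 2 = (Num.sqrt 2 / 2) ^+ 2); first
    by rewrite ltr_sqr ?nnegrE; lra.
  by rewrite expr_div_n sqr_sqrtr//; field.
have z21 : z ^+ 2 < 1 by apply: sqr_lt1; lra.
(* Solves [c ^+ 2 / disc c = 2 * z ^+ 2 - 1], see [zeta2B1]. *)
pose p := 2 * z ^+ 2 - 1.
have p01 : 0 < p < 1 by rewrite /p; lra.
pose k := Num.sqrt (1 - p ^+ 2).
have p2 : 0 < 1 - p ^+ 2 by nra.
have k0 : 0 < k by rewrite sqrtr_gt0.
have k2 : k ^+ 2 = 1 - p ^+ 2 by rewrite sqr_sqrtr ?ltW.
have pk : 0 < 2 * p / k by rewrite divr_gt0//; lra.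
pose c := Num.sqrt (2 * p / k); exists c; first by rewrite sqrtr_gt0.
have c2 : c ^+ 2 = 2 * p / k by rewrite sqr_sqrtr ?ltW.
have kn : k != 0 by rewrite gt_eqF.
have dE : disc c = 2 / k.
  rewrite /disc -[RHS]ger0_norm ?divr_ge0 ?(ltW k0)// -sqrtr_sqr.
  congr Num.sqrt; rewrite (_ : c ^+ 4 = c ^+ 2 ^+ 2); last by rewrite -exprM.
  rewrite c2 !expr_div_n k2 exprMn; field.
  by rewrite gt_eqF.
have c0 : 0 < c by rewrite sqrtr_gt0.
apply/eqP; rewrite -(eqrXn2 (n := 2)) ?zeta_ge0 ?(ltW z0)//; apply/eqP.
rewrite sqr_zeta// c2 dE /p; field.
by rewrite kn.
Qed.

Definition AR_modulus z :=
  - (4 * pi) * (Num.sqrt (2 * z ^+ 2 - 1))^-1 * ellipticG z.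

Lemma catenoid_AR_modulus c : 0 < c -> catenoid_AR c = AR_modulus (zeta c).
Proof. by move=> c0; have [_ ->] := catenoid_ARP c0; rewrite scaleE. Qed.

Lemma modulus_range z : Num.sqrt 2 / 2 < z < 1 ->
  [/\ 0 < z, z < 1 & 0 < 2 * z ^+ 2 - 1].
Proof.
move=> /andP[zl zr]; have s2 : 0 < Num.sqrt 2 :> R by rewrite sqrtr_gt0.
have z0 : 0 < z by lra.
split => //; have : (Num.sqrt 2 / 2) ^+ 2 < z ^+ 2.
  by rewrite ltr_sqr ?nnegrE; lra.
by rewrite expr_div_n sqr_sqrtr//; lra.
Qed.

Lemma has_deriv_AR_modulus z : Num.sqrt 2 / 2 < z < 1 ->
  has_deriv AR_modulus z (4 * pi * z * (2 * ellipticE z - ellipticK z)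
    / Num.sqrt (2 * z ^+ 2 - 1) ^+ 3).
Proof.
move=> /modulus_range[z0 z1 p0].
have s0 : Num.sqrt (2 * z ^+ 2 - 1) != 0 by rewrite gt_eqF ?sqrtr_gt0.
have s2 : Num.sqrt (2 * z ^+ 2 - 1) ^+ 2 = 2 * z ^+ 2 - 1
  by rewrite sqr_sqrtr ?ltW.
rewrite /AR_modulus; apply: has_deriv_eq.
  apply: has_derivM; last by apply: has_deriv_ellipticG; rewrite z0.
  apply: has_derivM; first exact: has_deriv_cst.
  by apply: has_derivV => //; derive_rules.
cbv beta; rewrite /ellipticG.
move: (Num.sqrt _) s0 s2 => s s0 s2.
by field: s2; rewrite s0.
Qed.

Definition dAR c :=
  4 * pi * zeta c * (2 * ellipticE (zeta c) - ellipticK (zeta c))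
  / Num.sqrt (2 * zeta c ^+ 2 - 1) ^+ 3 * (2 * c / (disc c ^+ 3 * zeta c)).

Lemma has_deriv_AR c : 0 < c -> has_deriv (@catenoid_AR R) c (dAR c).
Proof.
move=> c0.
have h : has_deriv (fun c => AR_modulus (zeta c)) c (dAR c).
  apply: (has_deriv_comp (f := AR_modulus)); last exact: has_deriv_zeta.
  exact: has_deriv_AR_modulus (zeta_bounds c0).
apply: near_eq_is_derive h; near=> x.
by rewrite catenoid_AR_modulus//; near: x; exact: lt_nbhsr.
Unshelve. all: by end_near. Qed.

Lemma dAR_factor c : 0 < c -> exists2 k, 0 < k &
  dAR c = k * (2 * ellipticE (zeta c) - ellipticK (zeta c)).
Proof.
move=> c0; have [z0 z1 p0] := modulus_range (zeta_bounds c0).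
exists (4 * pi * zeta c / Num.sqrt (2 * zeta c ^+ 2 - 1) ^+ 3 *
  (2 * c / (disc c ^+ 3 * zeta c))); last by rewrite /dAR; ring.
have d0 := disc_gt0 c0; have p1 := @pi_gt0 R.
apply: mulr_gt0; apply: divr_gt0.
- by rewrite !mulr_gt0.
- by rewrite exprn_gt0// sqrtr_gt0.
- by rewrite mulr_gt0.
- by rewrite mulr_gt0// exprn_gt0.
Qed.

Section critical_parameter.
Variables zp cp : R.
Hypotheses (zp1 : Num.sqrt 2 / 2 < zp < 1).
Hypotheses (zpKE : ellipticK zp = 2 * ellipticE zp).
Hypotheses (cp0 : 0 < cp) (cpz : zeta cp = zp).

Lemma K2E_sign z : Num.sqrt 2 / 2 < z < 1 ->
  (z < zp -> 0 < 2 * ellipticE z - ellipticK z) /\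
  (zp < z -> 2 * ellipticE z - ellipticK z < 0).
Proof.
move=> zr; have [z0 z1 _] := modulus_range zr;
  have [w0 w1 _] := modulus_range zp1.
split=> zz.
  by have := K2E_lt (ltW z0) zz w1; rewrite zpKE; lra.
by have := K2E_lt (ltW w0) zz z1; rewrite zpKE; lra.
Qed.

Lemma critical_modulus_unique z : Num.sqrt 2 / 2 < z < 1 ->
  ellipticK z = 2 * ellipticE z <-> z = zp.
Proof.
move=> zr; have [lo hi] := K2E_sign zr; split=> [e|->//].
have [zz|zz|//] := ltgtP z zp; first by have := lo zz; lra.
by have := hi zz; lra.
Qed.

Lemma dAR_gt0 c : 0 < c -> c < cp -> 0 < dAR c.
Proof.
move=> c0 cc; have [k k0 ->] := dAR_factor c0; rewrite mulr_gt0//.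
by have [lo _] := K2E_sign (zeta_bounds c0); apply: lo; rewrite -cpz zeta_lt.
Qed.

Lemma dAR_lt0 c : cp < c -> dAR c < 0.
Proof.
move=> cc; have c0 := lt_trans cp0 cc.
have [k k0 ->] := dAR_factor c0; rewrite pmulr_rlt0//.
by have [_ hi] := K2E_sign (zeta_bounds c0); apply: hi; rewrite -cpz zeta_lt.
Qed.

Lemma dAR_eq0 c : 0 < c -> dAR c = 0 <-> c = cp.
Proof.
move=> c0; split=> [d0|->].
  have [cc|cc|//] := ltgtP c cp; first by have := dAR_gt0 c0 cc; lra.
  by have := dAR_lt0 cc; lra.
by have [k k0 ->] := dAR_factor cp0; rewrite cpz zpKE subrr mulr0.
Qed.

Lemma AR_increasing c d : 0 < c -> c < d -> d <= cp ->
  catenoid_AR c < catenoid_AR d.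
Proof.
move=> c0 cd dcp;
  apply: (@has_deriv_gt0_lt _ (@catenoid_AR R) c d dAR) => // x xI.
  by apply: has_deriv_AR; lra.
by apply: dAR_gt0; lra.
Qed.

Lemma AR_decreasing c d : cp <= c -> c < d -> catenoid_AR d < catenoid_AR c.
Proof.
move=> cpc cd; rewrite -ltrN2.
apply: (@has_deriv_gt0_lt _ (fun x => - catenoid_AR x) c d
  (fun x => - dAR x)) => // x xI.
  by apply: has_derivN; apply: has_deriv_AR; have := cp0; lra.
by rewrite oppr_gt0; apply: dAR_lt0; lra.
Qed.

Lemma AR_max c : 0 < c -> catenoid_AR c <= catenoid_AR cp.
Proof.
move=> c0; have [cc|cc|->//] := ltgtP c cp; apply: ltW.
  exact: AR_increasing.
exact: AR_decreasing.
Qed.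

Lemma AR_critical_value : catenoid_AR cp =
  - (4 * pi) * Num.sqrt (2 * zp ^+ 2 - 1) * ellipticE zp.
Proof.
rewrite catenoid_AR_modulus// cpz /AR_modulus /ellipticG zpKE.
have [_ _ p0] := modulus_range zp1.
have s0 : Num.sqrt (2 * zp ^+ 2 - 1) != 0 by rewrite gt_eqF ?sqrtr_gt0.
have s2 : Num.sqrt (2 * zp ^+ 2 - 1) ^+ 2 = 2 * zp ^+ 2 - 1.
  by rewrite sqr_sqrtr ?ltW.
move: (Num.sqrt _) s0 s2 => s s0 s2.
by field: s2; rewrite s0.
Qed.

End critical_parameter.

(** The elementary lower bound [z ^+ 2 * (pi / 4)] of [ellipticG z] suffices,
    because [2 * z ^+ 2 - 1 < z ^+ 4]. *)
Lemma AR_lt_sqr_pi c : 0 < c -> catenoid_AR c < - pi ^+ 2.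
Proof.
move=> c0; rewrite catenoid_AR_modulus//.
have [z0 z1 p0] := modulus_range (zeta_bounds c0).
have z21 : zeta c ^+ 2 < 1 by apply: sqr_lt1; lra.
have s0 : 0 < Num.sqrt (2 * zeta c ^+ 2 - 1) by rewrite sqrtr_gt0.
have sz : Num.sqrt (2 * zeta c ^+ 2 - 1) < zeta c ^+ 2.
  rewrite -[ltRHS]ger0_norm ?sqr_ge0// -sqrtr_sqr ltr_sqrt ?exprn_gt0//.
  have : 0 < (1 - zeta c ^+ 2) ^+ 2 by rewrite exprn_gt0// subr_gt0.
  by rewrite sqrrB; lra.
have Gz := ellipticG_ge_quarter_pi z21; have p1 := @pi_gt0 R.
rewrite /AR_modulus !mulNr ltrN2 mulrAC ltr_pdivlMr//.
have h1 : pi ^+ 2 * Num.sqrt (2 * zeta c ^+ 2 - 1) < pi ^+ 2 * zeta c ^+ 2.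
  by rewrite ltr_pM2l// exprn_gt0.
apply: (lt_le_trans h1).
have -> : pi ^+ 2 * zeta c ^+ 2 = 4 * pi * (zeta c ^+ 2 * (pi / 4)) :> R by field.
by rewrite ler_pM2l// mulr_gt0.
Qed.

Lemma scale_bounds c : 1 <= c ->
  1 <= scale c <= 1 + 4 / c ^+ 4 /\ Num.sqrt (1 - zeta c ^+ 2) <= 1 / c ^+ 2.
Proof.
move=> c1; have c0 : 0 < c by lra.
have d0 := disc_gt0 c0; have d1 := disc_gt c0; have d2 := sqr_disc c0.
have c40 : 0 < c ^+ 4 by rewrite exprn_gt0.
have c20 : 0 < c ^+ 2 by rewrite exprn_gt0.
have m0 := scale_gt0 c0.
have m2 : scale c ^+ 2 = disc c / c ^+ 2
  by rewrite expr_div_n sqr_sqrtr ?(ltW d0).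
have m4 : scale c ^+ 4 = 1 + 4 / c ^+ 4.
  rewrite (_ : scale c ^+ 4 = scale c ^+ 2 ^+ 2); last by rewrite -exprM.
  by rewrite m2 expr_div_n d2 -exprM; field; rewrite gt_eqF.
have m1 : 1 <= scale c.
  by rewrite -(@expr_ge1 _ 2) ?(ltW m0)// m2 ler_pdivlMr// mul1r ltW.
split.
  rewrite m1 -m4 -[leLHS]expr1; apply: ler_weXn2l => //.
rewrite -[leRHS]ger0_norm ?divr_ge0 ?(ltW c20)// -sqrtr_sqr ler_sqrt ?sqr_ge0//.
have -> : 1 - zeta c ^+ 2 = 2 / (disc c * (disc c + c ^+ 2)).
  rewrite sqr_zeta//; apply/eqP; rewrite subr_eq; apply/eqP.
  have dn : disc c != 0 by rewrite gt_eqF.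
  have dc : disc c + c ^+ 2 != 0 by rewrite gt_eqF// addr_gt0.
  have c4E : c ^+ 4 = disc c ^+ 2 - 4 by rewrite d2; ring.
  by field: c4E; rewrite dn dc.
rewrite expr_div_n expr1n -exprM ler_pdivrMr ?mulr_gt0 ?addr_gt0// mul1r.
rewrite mulrC ler_pdivlMr//.
have : c ^+ 4 = c ^+ 2 * c ^+ 2 by rewrite -exprD.
nra.
Qed.

Lemma AR_cvg0 : catenoid_AR c @[c --> (0 : R)^'+] --> -oo.
Proof.
apply/cvgrNyPle => A; near=> c.
have c0 : 0 < c by [].
have cA : c <= (`|A| + 1)^-1.
  by near: c; apply: nbhs_right_le; rewrite invr_gt0 ltr_wpDl.
have d0 := disc_gt0 c0; have d2 := sqr_disc c0.
have c40 : 0 < c ^+ 4 by rewrite exprn_gt0.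
have m0 := scale_gt0 c0.
have mc : c^-1 <= scale c.
  rewrite /scale -[leLHS]mul1r ler_pM2r ?invr_gt0//.
  by rewrite -sqrtr1 ler_sqrt ?(ltW d0)// -ler_sqr ?nnegrE ?(ltW d0)//; lra.
have [_ ->] := catenoid_ARP c0.
have z21 := sqr_zeta_lt1 c0; have Gz := ellipticG_ge_quarter_pi z21.
have z2 : 1 / 2 <= zeta c ^+ 2.
  by have [_ _] := modulus_range (zeta_bounds c0); lra.
have p2 := @pi_ge2 R.
have G1 : 1 / 4 <= ellipticG (zeta c).
  by apply: le_trans Gz; nra.
have mG : scale c * (1 / 4) <= scale c * ellipticG (zeta c) by rewrite ler_pM2l.
have Ac : - A <= c^-1.
  apply: (@le_trans _ _ (`|A| + 1)).
    by rewrite (le_trans (ler_norm _))// normrN lerDl.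
  by rewrite -[leLHS]invrK lef_pV2 ?posrE ?invr_gt0 ?ltr_wpDl.
have pm : 4 * pi * (scale c * (1 / 4)) <= 4 * pi * (scale c * ellipticG (zeta c)).
  by rewrite ler_pM2l// mulr_gt0//; lra.
have : 1 * scale c <= pi * scale c by rewrite ler_pM2r//; lra.
lra.
Unshelve. all: by end_near. Qed.

Lemma AR_cvgy : catenoid_AR c @[c --> +oo] --> - (4 * pi : R).
Proof.
apply/cvgrPdist_le => e e0; near=> c.
have c1 : 1 <= c by near: c; apply: nbhs_pinfty_ge; exact: num_real.
have ce : 16 * pi / e <= c by near: c; apply: nbhs_pinfty_ge; exact: num_real.
have c0 : 0 < c by lra.
have p0 := @pi_gt0 R; have p1 := @pihalf_lt2 R.
have [_ ->] := catenoid_ARP c0.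
have z21 := sqr_zeta_lt1 c0; have [/andP[m1 m2] sc] := scale_bounds c1.
have G1 := ellipticG_le1 z21; have G2 := ellipticG_ge z21.
have c20 : 0 < c^-1 by rewrite invr_gt0.
have c2c : 1 / c ^+ 2 <= c^-1.
  by rewrite div1r lef_pV2 ?posrE ?exprn_gt0// expr2 ler_peMl// ltW.
have c4c : 4 / c ^+ 4 <= 4 * c^-1.
  rewrite ler_pM2l// lef_pV2 ?posrE ?exprn_gt0//.
  by rewrite -[leLHS]expr1; apply: ler_weXn2l.
have G0 : 0 <= ellipticG (zeta c).
  apply: le_trans (ellipticG_ge_quarter_pi z21).
  by rewrite mulr_ge0 ?sqr_ge0// divr_ge0// ltW.
(* The factor [scale c] costs at most [4 / c ^+ 4] above [1], and [ellipticG]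
   at most [pi / 2 / c ^+ 2] below [1]. *)
have mG : `|scale c * ellipticG (zeta c) - 1| <= 4 * c^-1.
  rewrite ler_norml; apply/andP; split; nra.
have -> : - (4 * pi) - - (4 * pi) * scale c * ellipticG (zeta c) =
   4 * pi * (scale c * ellipticG (zeta c) - 1) :> R by ring.
rewrite normrM ger0_norm ?mulr_ge0 ?(ltW p0)//.
apply: (@le_trans _ _ (4 * pi * (4 * c^-1))).
  by rewrite ler_pM2l ?mulr_gt0.
rewrite ler_pdivrMr// in ce.
rewrite (_ : 4 * pi * (4 * c^-1) = 16 * pi / c); last by ring.
by rewrite ler_pdivrMr// [e * c]mulrC.
Unshelve. all: by end_near. Qed.

End parameter.

Theorem theorem4p1 (R : realType) :
  (forall c : R, 0 < c ->
    [/\ is_catenoid_AR c (catenoid_AR c),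
        Num.sqrt 2 / 2 < zeta c < 1 &
        catenoid_AR c = 4 * pi / Num.sqrt (2 * zeta c ^+ 2 - 1)
          * ((1 - zeta c ^+ 2) * ellipticK (zeta c) - ellipticE (zeta c))])
  /\
  exists zp cp : R,
    [/\ Num.sqrt 2 / 2 < zp < 1
          /\ (forall z : R, Num.sqrt 2 / 2 < z < 1 ->
                ellipticK z = 2 * ellipticE z <-> z = zp),
        0 < cp /\ zeta cp = zp,
        (forall c : R, 0 < c ->
          derivable (@catenoid_AR R) c 1
          /\ (derive1 (@catenoid_AR R) c = 0 <-> c = cp)),
        (forall c : R, 0 < c -> catenoid_AR c <= catenoid_AR cp) &
        [/\ (forall c d : R, 0 < c -> c < d -> d <= cp ->
               catenoid_AR c < catenoid_AR d),
            (forall c d : R, cp <= c -> c < d ->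
               catenoid_AR d < catenoid_AR c),
            catenoid_AR c @[c --> (0 : R)^'+] --> -oo,
            catenoid_AR c @[c --> +oo] --> - (4 * pi : R) &
            catenoid_AR cp
              = - (4 * pi) * Num.sqrt (2 * zp ^+ 2 - 1) * ellipticE zp
            /\ - (4 * pi) < catenoid_AR cp < - pi ^+ 2]].
Proof.
split.
  move=> c c0; have [isAR ARE] := catenoid_ARP c0.
  split=> //; first exact: zeta_bounds.
  by rewrite ARE scaleE// /ellipticG; ring.
have [zp zp1 zpKE] := @critical_modulus_exists R.
have [cp cp0 cpz] := zeta_surj zp1.
exists zp, cp; split.
- by split=> // z; exact: critical_modulus_unique.
- by [].
- move=> c c0; have dc := has_deriv_AR c0; split.
    exact: (@ex_derive _ _ _ _ _ _ _ dc).
  rewrite (has_deriv_derive1 dc).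
  exact: (dAR_eq0 zp1 zpKE cp0 cpz c0).
- by move=> c c0; exact: (AR_max zp1 zpKE cp0 cpz c0).
- split.
  + by move=> c d c0 cd dcp; exact: (AR_increasing zp1 zpKE cpz c0 cd dcp).
  + by move=> c d cpc cd; exact: (AR_decreasing zp1 zpKE cp0 cpz cpc cd).
  + exact: AR_cvg0.
  + exact: AR_cvgy.
  split; first exact: (AR_critical_value zp1 zpKE cp0 cpz).
  rewrite AR_lt_sqr_pi// andbT.
  apply: cvgy_lt_decreasing AR_cvgy => c d cpc cd.
  exact: (AR_decreasing zp1 zpKE cp0 cpz cpc cd).
Qed.
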